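(* Let $n\ge1$ and $\sigma\in\mathcal W$. The ring $\mathrm{Diff}_{\mathbf h,\sigma}(n)$ admits the action of the Zhelobenko automorphisms (that is, for each $i=1,\dots,n-1$ the formulas defining $\check{\mathrm q}_i$ on generators extend to a ring automorphism of $\mathrm{Diff}_{\mathbf h,\sigma}(n)$) if and only if $\sigma$ is a polynomial, $\sigma\in\mathcal H$.
   Context: $\mathbb K$ is a field of characteristic $0$. $U(n)=\mathbb K[\tilde h_1,\dots,\tilde h_n]$ is the commutative polynomial ring, $\tilde h_{ij}=\tilde h_i-\tilde h_j$, and $\bar U(n)$ is the localization of $U(n)$ with respect to the multiplicative set generated by all $\tilde h_{ij}+a$, $a\in\mathbb Z$, $i\ne j$. For $p\in\bar U(n)$, $p[\pm\varepsilon_j]$ denotes the image of $p$ under the automorphism $\tilde h_i\mapsto\tilde h_i\pm\delta_{ij}$ ($i=1,\dots,n$). $\Delta_j f:=f-f[-\varepsilon_j]$. $\chi_j:=\prod_{k\ne j}\tilde h_{jk}$; $\mathcal W_j$ is the $\mathbb K$-vector space of elements $\pi(\tilde h_j)/\chi_j$ with $\pi$ a univariate polynomial over $\mathbb K$; $\mathcal W:=\sum_{j=1}^n\mathcal W_j$. $\mathcal H\subset\mathcal W$ is the $\mathbb K$-span of the complete symmetric polynomials $H_L=\sum_{i_1\le\dots\le i_L}\tilde h_{i_1}\cdots\tilde h_{i_L}$, $L\ge0$. For $\sigma\in\mathcal W$ put $\sigma_i:=\Delta_i\sigma$. The ring $\mathrm{Diff}_{\mathbf h,\sigma}(n)$ is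 the ring generated over $\bar U(n)$ by $x^i,\bar\partial_i$, $i=1,\dots,n$, with the defining relations $\tilde h_i x^j=x^j(\tilde h_i+\delta_{ij})$, $\tilde h_i\bar\partial_j=\bar\partial_j(\tilde h_i-\delta_{ij})$ for all $i,j$ (hence $p\,x^j=x^j\,p[\varepsilon_j]$, $p\,\bar\partial_j=\bar\partial_j\,p[-\varepsilon_j]$ for $p\in\bar U(n)$), together with $$x^ix^j=\frac{\tilde h_{ij}+1}{\tilde h_{ij}}x^jx^i,\qquad \bar\partial_i\bar\partial_j=\frac{\tilde h_{ij}-1}{\tilde h_{ij}}\bar\partial_j\bar\partial_i\qquad(i<j),$$ $$x^i\bar\partial_j=\bar\partial_jx^i\ \ (i<j),\qquad x^i\bar\partial_j=\frac{\tilde h_{ij}(\tilde h_{ij}-2)}{(\tilde h_{ij}-1)^2}\bar\partial_jx^i\ \ (i>j),$$ $$x^i\bar\partial_i=\sum_{j=1}^n\frac{1}{1-\tilde h_{ij}}\bar\partial_jx^j-\sigma_i,\qquad i=1,\dots,n.$$ The Zhelobenko maps $\check{\mathrm q}_i$, $i=1,\dots,n-1$, are given on generators by $$\check{\mathrm q}_i(x^i)=-x^{i+1}\frac{\tilde h_{i,i+1}}{\tilde h_{i,i+1}-1},\quad \check{\mathrm q}_i(x^{i+1})=x^i,\quad \check{\mathrm q}_i(x^j)=x^j\ (j\ne i,i+1),$$ $$\check{\mathrm q}_i(\bar\partial_i)=-\frac{\tilde h_{i,i+1}-1}{\tilde h_{i,i+1}}\bar\partial_{i+1},\quad \check{\mathrm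 q}_i(\bar\partial_{i+1})=\bar\partial_i,\quad \check{\mathrm q}_i(\bar\partial_j)=\bar\partial_j\ (j\ne i,i+1),$$ $$\check{\mathrm q}_i(\tilde h_j)=\tilde h_{s_i(j)},$$ where $s_i$ is the transposition $(i,i+1)$. *)

(* Defs.v *)
From HB Require Import structures.
From mathcomp Require Import all_boot all_order all_algebra perm.
From mathcomp Require Import mpoly.
From mathcomp Require Import boolp.

Set Implicit Arguments.
Unset Strict Implicit.
Unset Printing Implicit Defensive.

Import GRing.Theory.

Local Open Scope ring_scope.
Local Open Scope quotient_scope.

Section PresentedRing.
Variable G : Type.

Inductive rterm : Type :=
| Gen of G
| Zero
| One
| Opp of rterm
| Add of rterm & rterm
| Mul of rterm & rterm.

(* The smallest congruence containing [R] for which the quotient of the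
   terms satisfies the axioms of a (unital, noncommutative) ring. *)
Inductive rcong (R : rterm -> rterm -> Prop) : rterm -> rterm -> Prop :=
| rc_rel s t : R s t -> rcong R s t
| rc_refl t : rcong R t t
| rc_sym s t : rcong R s t -> rcong R t s
| rc_trans s t u : rcong R s t -> rcong R t u -> rcong R s u
| rc_opp s s' : rcong R s s' -> rcong R (Opp s) (Opp s')
| rc_add s s' t t' :
    rcong R s s' -> rcong R t t' -> rcong R (Add s t) (Add s' t')
| rc_mul s s' t t' :
    rcong R s s' -> rcong R t t' -> rcong R (Mul s t) (Mul s' t')
| rc_addA s t u : rcong R (Add s (Add t u)) (Add (Add s t) u)
| rc_addC s t : rcong R (Add s t) (Add t s)
| rc_add0 t : rcong R (Add Zero t) t
| rc_addN t : rcong R (Add (Opp t) t) Zero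
| rc_mulA s t u : rcong R (Mul s (Mul t u)) (Mul (Mul s t) u)
| rc_mul1l t : rcong R (Mul One t) t
| rc_mul1r t : rcong R (Mul t One) t
| rc_mulDl s t u : rcong R (Mul (Add s t) u) (Add (Mul s u) (Mul t u))
| rc_mulDr s t u : rcong R (Mul s (Add t u)) (Add (Mul s t) (Mul s u)).

HB.instance Definition _ := gen_eqMixin rterm.
HB.instance Definition _ := gen_choiceMixin rterm.

Variable R : rterm -> rterm -> Prop.

Definition rcongb : rel rterm := fun s t => `[< rcong R s t >].

Lemma rcongb_refl : reflexive rcongb.
Proof. by move=> t; apply/asboolP/rc_refl. Qed.

Lemma rcongb_sym s t : rcongb s t = rcongb t s.
Proof. by apply/asboolP/asboolP; apply: rc_sym. Qed.

Lemma rcongb_trans : transitive rcongb.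
Proof.
by move=> t s u /asboolP st /asboolP tu; apply/asboolP/(rc_trans st tu).
Qed.

Canonical rcong_equiv := EquivRel rcongb rcongb_refl rcongb_sym rcongb_trans.

Definition presented : Type := {eq_quot rcongb}.
HB.instance Definition _ := EqQuotient.on presented.
HB.instance Definition _ := Choice.on presented.

Definition pclass (t : rterm) : presented := \pi_presented t.

Lemma pclassP s t : pclass s = pclass t <-> rcong R s t.
Proof.
split=> [/(@eqmodP _ rcong_equiv)/asboolP //|st].
by apply/(@eqmodP _ rcong_equiv)/asboolP.
Qed.

Lemma pclass_ind (P : presented -> Prop) : (forall t, P (pclass t)) ->
  forall x, P x.
Proof. by move=> H x; rewrite -[x]reprK; apply: H. Qed.

Lemma repr_pclass t : rcong R (repr (pclass t)) t.
Proof. by apply/pclassP; rewrite /pclass reprK. Qed.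

Definition padd (a b : presented) := pclass (Add (repr a) (repr b)).
Definition pmul (a b : presented) := pclass (Mul (repr a) (repr b)).
Definition popp (a : presented) := pclass (Opp (repr a)).

Lemma padd_class s t : padd (pclass s) (pclass t) = pclass (Add s t).
Proof. by apply/pclassP/rc_add; apply: repr_pclass. Qed.

Lemma pmul_class s t : pmul (pclass s) (pclass t) = pclass (Mul s t).
Proof. by apply/pclassP/rc_mul; apply: repr_pclass. Qed.

Lemma popp_class t : popp (pclass t) = pclass (Opp t).
Proof. by apply/pclassP/rc_opp; apply: repr_pclass. Qed.

Lemma paddA : associative padd.
Proof.
elim/pclass_ind=> s; elim/pclass_ind=> t; elim/pclass_ind=> u.
by rewrite !padd_class; apply/pclassP/rc_addA.
Qed.

Lemma paddC : commutative padd.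
Proof.
elim/pclass_ind=> s; elim/pclass_ind=> t.
by rewrite !padd_class; apply/pclassP/rc_addC.
Qed.

Lemma padd0 : left_id (pclass Zero) padd.
Proof. by elim/pclass_ind=> t; rewrite padd_class; apply/pclassP/rc_add0. Qed.

Lemma paddN : left_inverse (pclass Zero) popp padd.
Proof.
by elim/pclass_ind=> t; rewrite popp_class padd_class; apply/pclassP/rc_addN.
Qed.

Lemma pmulA : associative pmul.
Proof.
elim/pclass_ind=> s; elim/pclass_ind=> t; elim/pclass_ind=> u.
by rewrite !pmul_class; apply/pclassP/rc_mulA.
Qed.

Lemma pmul1l : left_id (pclass One) pmul.
Proof. by elim/pclass_ind=> t; rewrite pmul_class; apply/pclassP/rc_mul1l. Qed.

Lemma pmul1r : right_id (pclass One) pmul.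
Proof. by elim/pclass_ind=> t; rewrite pmul_class; apply/pclassP/rc_mul1r. Qed.

Lemma pmulDl : left_distributive pmul padd.
Proof.
elim/pclass_ind=> s; elim/pclass_ind=> t; elim/pclass_ind=> u.
by rewrite padd_class !pmul_class padd_class; apply/pclassP/rc_mulDl.
Qed.

Lemma pmulDr : right_distributive pmul padd.
Proof.
elim/pclass_ind=> s; elim/pclass_ind=> t; elim/pclass_ind=> u.
by rewrite padd_class !pmul_class padd_class; apply/pclassP/rc_mulDr.
Qed.

HB.instance Definition _ :=
  GRing.isZmodule.Build presented paddA paddC padd0 paddN.
HB.instance Definition _ := GRing.Zmodule_isPzRing.Build presented
  pmulA pmul1l pmul1r pmulDl pmulDr.

End PresentedRing.

Arguments Zero {G}.
Arguments One {G}.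
Arguments pclass {G}.

Declare Scope rterm_scope.
Delimit Scope rterm_scope with rt.
Bind Scope rterm_scope with rterm.
Notation "0" := Zero : rterm_scope.
Notation "1" := One : rterm_scope.
Notation "s + t" := (Add s t) : rterm_scope.
Notation "s * t" := (Mul s t) : rterm_scope.
Notation "- t" := (Opp t) : rterm_scope.
Notation "s - t" := (Add s (Opp t)) : rterm_scope.

Section Localization.
Variables (K : fieldType) (n : nat).

Local Notation "p %:F" := (FracField.tofrac p).

(* The multiplicative set generated by the [h_i - h_j + a] for [i != j]; the
   localization [Ubar] is the subring of the fractions with denominator in it.
   *)
Inductive hset : {mpoly K[n]} -> Prop :=
| hset1 : hset 1
| hsetM (i j : 'I_n) (a : int) (q : {mpoly K[n]}) :
    i != j -> hset q -> hset (('X_i - 'X_j + a%:~R) * q).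

Definition inUbar : {pred {fraction {mpoly K[n]}}} := fun x =>
  `[< exists pq : {mpoly K[n]} * {mpoly K[n]},
        hset pq.2 /\ x = pq.1%:F / pq.2%:F >].

Lemma hset_mul q r : hset q -> hset r -> hset (q * r).
Proof.
move=> hq hr; elim: hq => [|i j a q' ij _ IH]; first by rewrite mul1r.
by rewrite -mulrA; apply: hsetM.
Qed.

Lemma hlin_neq0 (i j : 'I_n) (a : int) : i != j ->
  ('X_i - 'X_j + a%:~R : {mpoly K[n]}) != 0.
Proof.
move=> ij; apply/negP=> /eqP/(congr1 (mcoeff U_(i))).
rewrite mcoeffD mcoeffB !mcoeffXU eqxx eq_sym (negbTE ij) subr0 mcoeff0.
rewrite -(rmorph_int (@mpolyC n K)) mcoeffC mnm1_eq0 mulr0 addr0.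
by move/eqP; rewrite oner_eq0.
Qed.

Lemma hset_neq0 q : hset q -> q != 0.
Proof.
elim=> [|i j a {}q ij _ q0]; first exact: oner_neq0.
by rewrite mulf_neq0 // hlin_neq0.
Qed.

Lemma hset_fneq0 q : hset q -> q%:F != 0.
Proof. by move=> /hset_neq0; rewrite tofrac_eq0. Qed.

Lemma inUbarP x : reflect (exists pq : {mpoly K[n]} * {mpoly K[n]},
  hset pq.2 /\ x = pq.1%:F / pq.2%:F) (x \in inUbar).
Proof. exact: asboolP. Qed.

Lemma inUbar_subring : subring_closed inUbar.
Proof.
split=> [|x y|x y].
- by apply/inUbarP; exists (1, 1); split; [exact: hset1 | rewrite tofrac1 divr1].
- move=> /inUbarP[[p q] /= [hq ->]] /inUbarP[[r s] /= [hs ->]].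
  apply/inUbarP; exists (p * s - r * q, q * s); split; first exact: hset_mul.
  rewrite /= tofracB !tofracM -mulNr addf_div ?hset_fneq0 //.
  by rewrite mulNr.
- move=> /inUbarP[[p q] /= [hq ->]] /inUbarP[[r s] /= [hs ->]].
  apply/inUbarP; exists (p * r, q * s); split; first exact: hset_mul.
  by rewrite /= !tofracM mulf_div.
Qed.

HB.instance Definition _ :=
  GRing.isSubringClosed.Build {fraction {mpoly K[n]}} inUbar inUbar_subring.

Record Ubar : Type := MkUbar {
  ubar_val : {fraction {mpoly K[n]}};
  _ : ubar_val \in inUbar }.

HB.instance Definition _ := [isSub for ubar_val].
HB.instance Definition _ := [Choice of Ubar by <:].
HB.instance Definition _ := [SubChoice_isSubComNzRing of Ubar by <:].

Lemma ubar_val_inj (x y : Ubar) : ubar_val x = ubar_val y -> x = y.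
Proof. exact: val_inj. Qed.

Lemma ubar_valB (x y : Ubar) : ubar_val (x - y) = ubar_val x - ubar_val y.
Proof. by []. Qed.

Lemma ubar_valM (x y : Ubar) : ubar_val (x * y) = ubar_val x * ubar_val y.
Proof. by []. Qed.

Definition ubar_unit : {pred Ubar} := fun x =>
  (x != 0) && ((ubar_val x)^-1 \in inUbar).

Definition ubar_inv (x : Ubar) : Ubar :=
  if x != 0 then insubd x (ubar_val x)^-1 else x.

Lemma ubar_mulV : {in ubar_unit, left_inverse 1 ubar_inv *%R}.
Proof.
move=> x /andP[x0 xV]; apply: val_inj; rewrite rmorphM /= /ubar_inv x0.
by rewrite insubdK // mulVf // -[0]/(val (0 : Ubar)) (inj_eq val_inj).
Qed.

Lemma ubar_unitP (x y : Ubar) : y * x = 1 -> ubar_unit x.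
Proof.
move=> yx; have x0 : x != 0.
  by apply/eqP=> x0; move/eqP: yx; rewrite x0 mulr0 eq_sym oner_eq0.
rewrite /ubar_unit x0 /=; have vx0 : ubar_val x != 0.
  by rewrite -[0]/(val (0 : Ubar)) (inj_eq val_inj).
have -> : (ubar_val x)^-1 = ubar_val y; last exact: valP y.
apply: (mulIf vx0); rewrite mulVf //.
by rewrite -[LHS]/(ubar_val (1 : Ubar)) -yx.
Qed.

Lemma ubar_inv_out : {in [predC ubar_unit], ubar_inv =1 id}.
Proof.
move=> x; rewrite inE /= unfold_in /ubar_unit /ubar_inv.
by case: (x != 0) => //= xV; apply: val_inj; rewrite val_insubd (negbTE xV).
Qed.

(* [x^-1] is the inverse of [x] when [x] is invertible in [Ubar], and [x]
   otherwise. *)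
HB.instance Definition _ := GRing.ComNzRing_hasMulInverse.Build Ubar
  ubar_mulV ubar_unitP ubar_inv_out.

Lemma polyU_subproof (p : {mpoly K[n]}) : p%:F \in inUbar.
Proof.
by apply/inUbarP; exists (p, 1); split; [exact: hset1 | rewrite /= tofrac1 divr1].
Qed.

Definition polyU (p : {mpoly K[n]}) : Ubar := MkUbar (polyU_subproof p).

Definition scalU (c : K) : Ubar := polyU c%:MP.

Definition hvar (i : 'I_n) : Ubar := polyU 'X_i.

Definition hdiff (i j : 'I_n) : Ubar := hvar i - hvar j.

Lemma polyU_is_zmod : zmod_morphism polyU.
Proof. by move=> p q; apply: val_inj; rewrite /= tofracB. Qed.

Lemma polyU_is_monoid : monoid_morphism polyU.
Proof. by split=> [|p q]; apply: val_inj; rewrite /= ?tofrac1 ?tofracM. Qed.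

HB.instance Definition _ :=
  GRing.isZmodMorphism.Build {mpoly K[n]} Ubar polyU polyU_is_zmod.
HB.instance Definition _ :=
  GRing.isMonoidMorphism.Build {mpoly K[n]} Ubar polyU polyU_is_monoid.

Lemma polyU_inj : injective polyU.
Proof. by move=> p q /(congr1 ubar_val)/eqP /=; rewrite tofrac_eq => /eqP. Qed.

Lemma hdiff_unit (i j : 'I_n) (a : int) :
  i != j -> hdiff i j + a%:~R \is a GRing.unit.
Proof.
move=> ij; have -> : hdiff i j + a%:~R = polyU ('X_i - 'X_j + a%:~R).
  by rewrite rmorphD rmorphB rmorph_int.
apply/andP; split.
  by rewrite -(rmorph0 polyU) (inj_eq polyU_inj) hlin_neq0.
apply/inUbarP; exists (1, ('X_i - 'X_j + a%:~R) * 1); split.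
  by apply: hsetM ij hset1.
by rewrite /= mulr1 tofrac1 div1r.
Qed.

Definition pshift (a : int) (j : 'I_n) (p : {mpoly K[n]}) : {mpoly K[n]} :=
  p \mPo [tuple 'X_i + (a *+ (i == j))%:~R | i < n].

Lemma pshiftX a j i : pshift a j 'X_i = 'X_i + (a *+ (i == j))%:~R.
Proof. by rewrite /pshift comp_mpolyXU -tnth_nth tnth_mktuple. Qed.

HB.instance Definition _ a j := GRing.RMorphism.copy (pshift a j)
  (comp_mpoly [tuple 'X_i + (a *+ (i == j))%:~R | i < n]).

Lemma pshift_hset a j q : hset q -> hset (pshift a j q).
Proof.
elim=> [|i k b {}q ik _ IH]; first by rewrite rmorph1; exact: hset1.
rewrite rmorphM rmorphD rmorphB /= !pshiftX rmorph_int opprD addrACA.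
by rewrite -intrB -(addrA ('X_i - 'X_k)) -intrD; apply: hsetM.
Qed.

(* [ushift] extends [pshift] to the localization using an arbitrary choice of
   fractions with denominators in [hset]; [ushiftE] below shows that the result
   does not depend on this choice. *)
Definition ubar_frac (x : Ubar) : {mpoly K[n]} * {mpoly K[n]} :=
  projT1 (cid (inUbarP _ (valP x))).

Lemma ubar_fracP (x : Ubar) : hset (ubar_frac x).2 /\
  ubar_val x = (ubar_frac x).1%:F / (ubar_frac x).2%:F.
Proof. exact: projT2 (cid (inUbarP _ (valP x))). Qed.

Lemma ushift_subproof a j (x : Ubar) :
  (pshift a j (ubar_frac x).1)%:F / (pshift a j (ubar_frac x).2)%:F \in inUbar.
Proof.
apply/inUbarP; exists (pshift a j (ubar_frac x).1, pshift a j (ubar_frac x).2).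
by split=> //; apply: pshift_hset; case: (ubar_fracP x).
Qed.

Definition ushift (a : int) (j : 'I_n) (x : Ubar) : Ubar :=
  MkUbar (ushift_subproof a j x).

Lemma ushiftE a j (x : Ubar) p q : hset q -> ubar_val x = p%:F / q%:F ->
  ubar_val (ushift a j x) = (pshift a j p)%:F / (pshift a j q)%:F.
Proof.
move=> hq xE; rewrite /ushift /=; case: (ubar_fracP x).
case: (ubar_frac x) => r s /= hs; rewrite xE => /eqP.
rewrite eqr_div ?hset_fneq0 // -!tofracM tofrac_eq => /eqP e.
apply/eqP; rewrite eqr_div ?hset_fneq0 //; try exact: pshift_hset.
by rewrite -!tofracM tofrac_eq -!rmorphM e.
Qed.

Lemma ushift_polyU a j p : ushift a j (polyU p) = polyU (pshift a j p).
Proof.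
apply: ubar_val_inj; rewrite (@ushiftE _ _ _ p 1) /=.
- by rewrite rmorph1 tofrac1 divr1.
- exact: hset1.
by rewrite tofrac1 divr1.
Qed.

Lemma ushift_is_zmod a j : zmod_morphism (ushift a j).
Proof.
move=> x y; have [hq xE] := ubar_fracP x; have [hs yE] := ubar_fracP y.
move: (ubar_frac x) (ubar_frac y) hq hs xE yE => [p q] [r s] /= hq hs xE yE.
apply: ubar_val_inj; rewrite ubar_valB.
rewrite (ushiftE a j hq xE) (ushiftE a j hs yE).
rewrite (@ushiftE a j (x - y) (p * s - r * q) (q * s)).
- rewrite rmorphB !rmorphM tofracB !tofracM; apply/esym.
  rewrite -mulNr addf_div ?mulNr //;
  by apply/hset_fneq0/pshift_hset.
- exact: hset_mul.
rewrite ubar_valB xE yE tofracB !tofracM -mulNr addf_div ?mulNr //;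
by apply/hset_fneq0.
Qed.

Lemma ushift_is_monoid a j : monoid_morphism (ushift a j).
Proof.
split=> [|x y]; first by rewrite -(rmorph1 polyU) ushift_polyU !rmorph1.
have [hq xE] := ubar_fracP x; have [hs yE] := ubar_fracP y.
move: (ubar_frac x) (ubar_frac y) hq hs xE yE => [p q] [r s] /= hq hs xE yE.
apply: ubar_val_inj; rewrite ubar_valM.
rewrite (ushiftE a j hq xE) (ushiftE a j hs yE).
rewrite (@ushiftE a j (x * y) (p * r) (q * s)).
- by rewrite !rmorphM mulf_div.
- exact: hset_mul.
by rewrite ubar_valM xE yE !tofracM mulf_div.
Qed.

HB.instance Definition _ a j :=
  GRing.isZmodMorphism.Build Ubar Ubar (ushift a j) (ushift_is_zmod a j).
HB.instance Definition _ a j :=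
  GRing.isMonoidMorphism.Build Ubar Ubar (ushift a j) (ushift_is_monoid a j).

Definition Delta (j : 'I_n) (f : Ubar) : Ubar := f - ushift (-1) j f.

Definition chi (j : 'I_n) : Ubar := \prod_(k < n | k != j) hdiff j k.

Definition inWj (j : 'I_n) (f : Ubar) : Prop :=
  exists pi : {poly K}, f = polyU (map_poly (@mpolyC n K) pi).['X_j] / chi j.

Definition inW (f : Ubar) : Prop :=
  exists2 w : 'I_n -> Ubar, (forall j, inWj j (w j)) & f = \sum_(j < n) w j.

Definition hsym (L : nat) : {mpoly K[n]} :=
  \sum_(t : L.-tuple 'I_n | sorted leq (map val t)) \prod_(i <- t) 'X_i.

Definition is_polynomial (f : Ubar) : Prop := exists p, f = polyU p.

Definition inH (f : Ubar) : Prop :=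
  exists (d : nat) (c : 'I_d -> K),
    f = \sum_(L < d) scalU (c L) * polyU (hsym L).

End Localization.

Inductive diff_gen (K : fieldType) (n : nat) : Type :=
| GCoef of Ubar K n
| GX of 'I_n
| GD of 'I_n.

Section Diff.
Variables (K : fieldType) (n : nat).

Local Notation C p := (Gen (@GCoef K n p%R)).
Local Notation tx i := (Gen (@GX K n i)).
Local Notation td i := (Gen (@GD K n i)).

Inductive diff_rel (sigma : Ubar K n) :
    rterm (diff_gen K n) -> rterm (diff_gen K n) -> Prop :=
(* the coefficients form a homomorphic image of [Ubar K n], and the scalars
   of [K] are central *)
| dr_coef1 : diff_rel sigma (C 1) 1
| dr_coefD p q : diff_rel sigma (C (p + q)) (C p + C q)
| dr_coefM p q : diff_rel sigma (C (p * q)) (C p * C q)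
| dr_scalX c j : diff_rel sigma (C (scalU n c) * tx j) (tx j * C (scalU n c))
| dr_scalD c j : diff_rel sigma (C (scalU n c) * td j) (td j * C (scalU n c))
| dr_hX i j :
    diff_rel sigma (C (hvar K i) * tx j) (tx j * C (hvar K i + (i == j)%:R))
| dr_hD i j :
    diff_rel sigma (C (hvar K i) * td j) (td j * C (hvar K i - (i == j)%:R))
| dr_XX (i j : 'I_n) : (i < j)%N ->
    diff_rel sigma (tx i * tx j)
      (C ((hdiff K i j + 1) / hdiff K i j) * (tx j * tx i))
| dr_DD (i j : 'I_n) : (i < j)%N ->
    diff_rel sigma (td i * td j)
      (C ((hdiff K i j - 1) / hdiff K i j) * (td j * td i))
| dr_XD_lt (i j : 'I_n) : (i < j)%N -> diff_rel sigma (tx i * td j) (td j * tx i)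
| dr_XD_gt (i j : 'I_n) : (j < i)%N ->
    diff_rel sigma (tx i * td j)
      (C (hdiff K i j * (hdiff K i j - 2%:R) / (hdiff K i j - 1) ^+ 2)
         * (td j * tx i))
| dr_XD_eq (i : 'I_n) :
    diff_rel sigma (tx i * td i)
      (\big[@Add _/Zero]_(j < n) (C (1 / (1 - hdiff K i j)) * (td j * tx j))%rt
         - C (Delta i sigma)).

Definition Diff (sigma : Ubar K n) : Type := presented (diff_rel sigma).
HB.instance Definition _ sigma := GRing.PzRing.on (Diff sigma).

Definition coefD (sigma : Ubar K n) (p : Ubar K n) : Diff sigma :=
  pclass (diff_rel sigma) (C p).
Definition xD (sigma : Ubar K n) (i : 'I_n) : Diff sigma :=
  pclass (diff_rel sigma) (tx i).
Definition dD (sigma : Ubar K n) (i : 'I_n) : Diff sigma :=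
  pclass (diff_rel sigma) (td i).

(* [zhelobenko phi i i'] : the values of [phi] on the generators (the elements
   of [K], the [h_j], the [x^j] and the [d_j]) are those prescribed for the
   [i]-th Zhelobenko map, where [i'] stands for [i + 1]. The scalars of [K] are
   fixed since these maps are morphisms of [K]-algebras; for a ring morphism
   [phi], the values on [Ubar K n] are then determined. *)
Record zhelobenko (sigma : Ubar K n) (phi : Diff sigma -> Diff sigma)
    (i i' : 'I_n) : Prop := Zhelobenko {
  zh_scal : forall c : K, phi (coefD sigma (scalU n c)) = coefD sigma (scalU n c);
  zh_h : forall j,
    phi (coefD sigma (hvar K j)) = coefD sigma (hvar K (tperm i i' j));
  zh_x : phi (xD sigma i)
    = - (xD sigma i' * coefD sigma (hdiff K i i' / (hdiff K i i' - 1)));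
  zh_x' : phi (xD sigma i') = xD sigma i;
  zh_xj : forall j, j != i -> j != i' -> phi (xD sigma j) = xD sigma j;
  zh_d : phi (dD sigma i)
    = - (coefD sigma ((hdiff K i i' - 1) / hdiff K i i') * dD sigma i');
  zh_d' : phi (dD sigma i') = dD sigma i;
  zh_dj : forall j, j != i -> j != i' -> phi (dD sigma j) = dD sigma j }.

Definition admits_zhelobenko (sigma : Ubar K n) : Prop :=
  forall i i' : 'I_n, i' = i.+1 :> nat ->
    exists2 phi : {rmorphism Diff sigma -> Diff sigma},
      bijective phi & zhelobenko phi i i'.

End Diff.

(* Main.v *)
(* Let s be the transposition of the neighbours a, b = a + 1.  Applying the
   Zhelobenko map to the relation expressing x^b d_b gives, once Ubar is known
   to embed into Diff, Delta_a sigma = s (Delta_b sigma); so sigma - s sigma is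
   invariant under h_a |-> h_a - 1.  Its only possible pole along the lines
   h_a - h_b = m is at m = 0 and that of its shift at m = 1, so there is none;
   this forces pi_a = pi_b in sigma = \sum_j pi_j(h_j) / chi_j.  When all the
   pi_j coincide, sigma is in H because \sum_j h_j^m / chi_j = H_{m-n+1}.

   Ubar embeds because Diff acts on it:  with E_j = \prod_{k > j} (h_j - h_k),
   T_j the shift h_j |-> h_j - 1 and w_j = pi_j(h_j) / chi_j, let x^j act as
   E_j^{-1} T_j and d_j as w_j times the inverse of this operator.

   Conversely, for a symmetric sigma, the relations are preserved by
   x^j |-> x^{s j} u_j, d_j |-> u_j^{-1} d_{s j} provided the u_j satisfy three
   scalar identities; both the Zhelobenko map and its inverse are of this
   form. *)
Require Import Defs.
From HB Require Import structures.
From mathcomp Require Import all_boot all_order all_algebra perm.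
From mathcomp Require Import mpoly boolp ring zify.
Import GRing.Theory.
Local Open Scope ring_scope.

Set Implicit Arguments.
Unset Strict Implicit.
Unset Printing Implicit Defensive.

(** * Presented rings and the localization *)

Section PresentedRingTheory.
Variables (G : Type) (R : rterm G -> rterm G -> Prop).

Lemma pclassD s t : pclass R (Add s t) = pclass R s + pclass R t.
Proof. by rewrite -padd_class. Qed.

Lemma pclassM s t : pclass R (Mul s t) = pclass R s * pclass R t.
Proof. by rewrite -pmul_class. Qed.

Lemma pclassN t : pclass R (Opp t) = - pclass R t.
Proof. by rewrite -popp_class. Qed.

Lemma pclass_sum (I : Type) (r : seq I) (F : I -> rterm G) :
  pclass R (\big[@Add G/Zero]_(i <- r) F i) = \sum_(i <- r) pclass R (F i).
Proof. by apply: big_morph => // s t; rewrite pclassD. Qed.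

Lemma pclass_rel s t : R s t -> pclass R s = pclass R t.
Proof. by move=> st; apply/pclassP/rc_rel. Qed.

Lemma presented_rmorph_eq (A : pzRingType)
    (f g : {rmorphism presented R -> A}) :
  (forall x, f (pclass R (Gen x)) = g (pclass R (Gen x))) -> f =1 g.
Proof.
move=> fg; elim/pclass_ind=> t.
elim: t => [x|||t IH|s IHs t IHt|s IHs t IHt]; first exact: fg.
- by rewrite (_ : pclass R Zero = 0) // !rmorph0.
- by rewrite (_ : pclass R One = 1) // !rmorph1.
- by rewrite pclassN !rmorphN IH.
- by rewrite pclassD !rmorphD IHs IHt.
- by rewrite pclassM !rmorphM IHs IHt.
Qed.

Section Eval.
Variables (A : pzRingType) (g : G -> A).

Fixpoint reval (t : rterm G) : A :=
  match t with
  | Gen x => g x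
  | Zero => 0
  | One => 1
  | Opp t => - reval t
  | Add s t => reval s + reval t
  | Mul s t => reval s * reval t
  end.

Lemma reval_sum (I : Type) (r : seq I) (F : I -> rterm G) :
  reval (\big[@Add G/Zero]_(i <- r) F i) = \sum_(i <- r) reval (F i).
Proof. exact: (@big_morph _ _ reval 0 +%R). Qed.

Hypothesis gR : forall s t, R s t -> reval s = reval t.

Lemma reval_cong s t : rcong R s t -> reval s = reval t.
Proof.
elim=> //= *; rewrite ?addrA ?mulrA ?add0r ?addNr ?mul1r ?mulr1
  ?mulrDl ?mulrDr //; by [congruence | exact: gR | exact: addrC].
Qed.

(** Evaluation is constant on congruence classes, so evaluating any representative of a class gives
    a ring morphism. *)
Lemma presented_lift : exists f : {rmorphism presented R -> A},
  forall x, f (pclass R (Gen x)) = g x.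
Proof.
pose f (x : presented R) := reval (repr x).
have fE t : f (pclass R t) = reval t by apply/reval_cong/repr_pclass.
have fB : zmod_morphism f.
  elim/pclass_ind=> s; elim/pclass_ind=> t.
  by rewrite -pclassN -pclassD !fE.
have fM : monoid_morphism f.
  split; first exact: (fE One).
  by elim/pclass_ind=> s; elim/pclass_ind=> t; rewrite -pclassM !fE.
pose b1 := GRing.isZmodMorphism.Build _ _ f fB.
pose b2 := GRing.isMonoidMorphism.Build _ _ f fM.
pose fr : {rmorphism presented R -> A} := HB.pack f b1 b2.
by exists fr => x; apply: fE.
Qed.

End Eval.

End PresentedRingTheory.

(** The image of [x] is computed from one chosen numerator and denominator; [fE] shows that every
    other choice gives the same value, and the morphism laws are then checked on convenient
    fractions. *)
Lemma localization_lift (R : comPzRingType) (U V : comUnitRingType)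
    (S : R -> Prop) (iota : {rmorphism R -> U}) (g : {rmorphism R -> V}) :
    injective iota -> S 1 -> (forall p q, S p -> S q -> S (p * q)) ->
    (forall x, exists p q, S q /\ x * iota q = iota p) ->
    (forall q, S q -> g q \is a GRing.unit) ->
  exists f : {rmorphism U -> V}, forall p, f (iota p) = g p.
Proof.
move=> iota_inj S1 SM fracE gU.
have /choice[num numP] : forall x, exists pq : R * R,
    S pq.2 /\ x * iota pq.2 = iota pq.1.
  by move=> x; have [p [q pqP]] := fracE x; exists (p, q).
pose f x := g (num x).1 / g (num x).2.
have fE x p q : S q -> x * iota q = iota p -> f x = g p / g q.
  rewrite /f; have [] := numP x; case: (num x) => r s /= Ss xs Sq xq.
  apply: (mulIr (gU _ Ss)); rewrite divrK ?gU // mulrAC.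
  apply: (mulIr (gU _ Sq)); rewrite divrK ?gU // -!rmorphM; congr (g _).
  by apply: iota_inj; rewrite !rmorphM -xs -xq mulrAC.
have fp p : f (iota p) = g p.
  by rewrite (fE _ p 1) ?rmorph1 ?divr1 ?mulr1.
have fB : zmod_morphism f.
  move=> x y; have [p [q [Sq xE]]] := fracE x.
  have [p' [q' [Sq' yE]]] := fracE y.
  rewrite (fE x p q) // (fE y p' q') // (fE _ (p * q' - p' * q) (q * q')).
  - rewrite rmorphB !rmorphM /= invrM ?gU // mulrBl -!mulrA.
    congr (_ - _); first by rewrite mulVKr ?gU.
    by rewrite [g q * _]mulrCA divrr ?gU // mulr1.
  - exact: SM.
  by rewrite rmorphB !rmorphM mulrBl -xE -yE mulrA -!mulrA [iota q * _]mulrC.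
have fM : monoid_morphism f.
  split; first by rewrite -(rmorph1 iota) fp rmorph1.
  move=> x y; have [p [q [Sq xE]]] := fracE x.
  have [p' [q' [Sq' yE]]] := fracE y.
  rewrite (fE x p q) // (fE y p' q') // (fE _ (p * p') (q * q')).
  - by rewrite !rmorphM invrM ?gU // [(g q')^-1 * _]mulrC mulrACA.
  - exact: SM.
  by rewrite !rmorphM mulrACA xE yE.
pose b1 := GRing.isZmodMorphism.Build _ _ f fB.
pose b2 := GRing.isMonoidMorphism.Build _ _ f fM.
pose fr : {rmorphism U -> V} := HB.pack f b1 b2.
by exists fr => x; apply: fp.
Qed.

(** * The localization: generation by scalars and variables, shifts and permutations *)

Section UbarTheory.
Variables (K : fieldType) (n : nat).
Local Notation U := (Ubar K n).
Local Notation M := {mpoly K[n]}.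
Implicit Types (i j k : 'I_n) (p q r : M) (x y : U).

Lemma polyU_hset_unit q : hset q -> polyU q \is a GRing.unit.
Proof.
elim=> [|i j a {}q ij _ IH]; first by rewrite rmorph1 unitr1.
by rewrite rmorphM unitrM IH andbT rmorphD rmorphB rmorph_int hdiff_unit.
Qed.

Lemma Ubar_fracE x : exists p q, hset q /\ x = polyU p / polyU q.
Proof.
have /inUbarP[[p q] /= [hq xE]] := valP x; exists p, q; split=> //.
have qU := polyU_hset_unit hq; apply: (mulIr qU); rewrite divrK //.
apply: ubar_val_inj; rewrite ubar_valM /= xE divfK //.
exact: hset_fneq0.
Qed.

(** Scalars and variables yield all polynomials by sums and products, and a fraction needs only one
    more inversion, that of its denominator. *)
Lemma Ubar_ind (P : U -> Prop) :
    (forall c : K, P (scalU n c)) -> (forall i, P (hvar K i)) ->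
    (forall x y, P x -> P y -> P (x + y)) ->
    (forall x y, P x -> P y -> P (x * y)) ->
    (forall x, x \is a GRing.unit -> P x -> P x^-1) ->
  forall x, P x.
Proof.
move=> Pc Ph PD PM PV x; have [p [q [/polyU_hset_unit qU ->]]] := Ubar_fracE x.
have Pp r : P (polyU r).
  elim/mpolyind: r => [|c m r _ _ IH].
    by move: (Pc 0); rewrite /scalU mpolyC0.
  rewrite rmorphD -mul_mpolyC rmorphM; apply: (PD) => //; apply: (PM).
    exact: Pc.
  have P1 : P 1 by move: (Pc 1); rewrite /scalU mpolyC1 rmorph1.
  rewrite mpolyXE_id rmorph_prod; apply: (big_ind P) => [//|x1 x2|i _] /=.
    exact: PM.
  elim: (m i) => [|k IHk]; first by rewrite rmorph1.
  by rewrite exprS rmorphM; apply: PM (Ph i) IHk.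
by apply: (PM) => //; apply: PV.
Qed.

Lemma Ubar_rmorph_eq (A : pzRingType) (f g : {rmorphism U -> A}) :
    (forall c : K, f (scalU n c) = g (scalU n c)) ->
    (forall i, f (hvar K i) = g (hvar K i)) -> f =1 g.
Proof.
move=> fgc fgh; elim/Ubar_ind => // [x y IHx IHy|x y IHx IHy|x xU IH].
- by rewrite !rmorphD IHx IHy.
- by rewrite !rmorphM IHx IHy.
(* [A] need not be commutative nor have inverses: [f (x^-1)] is multiplied on the right by
   [g x * g (x^-1) = 1], and [g x] is replaced by [f x]. *)
rewrite -[f _]mulr1 -(rmorph1 g) -(divrr xU) (rmorphM g) mulrA -IH.
by rewrite -rmorphM mulVr // rmorph1 mul1r.
Qed.

Lemma ushift_scal a j (c : K) : ushift a j (scalU n c) = scalU n c.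
Proof. by rewrite /scalU ushift_polyU /pshift comp_mpolyC. Qed.

Lemma ushift_hvar a j i :
  ushift a j (hvar K i) = hvar K i + (a *+ (i == j))%:~R.
Proof. by rewrite ushift_polyU pshiftX rmorphD rmorph_int. Qed.

Lemma ushift_hdiff a j i k :
  ushift a j (hdiff K i k) = hdiff K i k + (a *+ (i == j) - a *+ (k == j))%:~R.
Proof. by rewrite rmorphB /= !ushift_hvar intrB opprD addrACA. Qed.

Lemma ushiftC a b i j x : ushift a i (ushift b j x) = ushift b j (ushift a i x).
Proof.
move: x; apply: (@Ubar_rmorph_eq _ (ushift a i \o ushift b j)
  (ushift b j \o ushift a i)) => [c|k] /=; first by rewrite !ushift_scal.
by rewrite !ushift_hvar !rmorphD /= !rmorph_int !ushift_hvar addrAC.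
Qed.

Lemma ushift_comp a b j x : ushift a j (ushift b j x) = ushift (a + b) j x.
Proof.
move: x; apply: (@Ubar_rmorph_eq _ (ushift a j \o ushift b j)
  (ushift (a + b) j)) => [c|k] /=; first by rewrite !ushift_scal.
by rewrite !ushift_hvar !rmorphD /= !rmorph_int !ushift_hvar mulrnDl intrD
  addrA.
Qed.

Lemma ushift0 j x : ushift 0 j x = x.
Proof.
move: x; apply: (@Ubar_rmorph_eq _ (ushift 0 j) idfun) => [c|k] /=.
  by rewrite ushift_scal.
by rewrite ushift_hvar mul0rn addr0.
Qed.

Section Permutation.
Variable s : 'S_n.

Definition pperm : M -> M := comp_mpoly [tuple 'X_(s i) | i < n].
HB.instance Definition _ := GRing.RMorphism.on pperm.

Lemma ppermX i : pperm 'X_i = 'X_(s i).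
Proof. by rewrite /pperm comp_mpolyXU -tnth_nth tnth_mktuple. Qed.

Lemma pperm_hset q : hset q -> hset (pperm q).
Proof.
elim=> [|i k b {}q ik _ IH]; first by rewrite rmorph1; apply: hset1.
rewrite rmorphM rmorphD rmorphB /= !ppermX rmorph_int.
by apply: hsetM => //; rewrite (inj_eq perm_inj).
Qed.

Lemma uperm_exists : exists f : {rmorphism U -> U},
  forall p, f (polyU p) = polyU (pperm p).
Proof.
apply: (localization_lift (S := @hset K n) (iota := @polyU K n)
  (g := @polyU K n \o pperm)).
- exact: polyU_inj.
- exact: hset1.
- exact: hset_mul.
- move=> x; have [p [q [hq ->]]] := Ubar_fracE x.
  by exists p, q; rewrite divrK ?polyU_hset_unit.
- by move=> q /pperm_hset/polyU_hset_unit.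
Qed.

Definition uperm : {rmorphism U -> U} := projT1 (cid uperm_exists).

Lemma uperm_polyU p : uperm (polyU p) = polyU (pperm p).
Proof. exact: projT2 (cid uperm_exists) p. Qed.

Lemma uperm_scal (c : K) : uperm (scalU n c) = scalU n c.
Proof. by rewrite uperm_polyU /pperm comp_mpolyC. Qed.

Lemma uperm_hvar i : uperm (hvar K i) = hvar K (s i).
Proof. by rewrite uperm_polyU ppermX. Qed.

Lemma uperm_hdiff i j : uperm (hdiff K i j) = hdiff K (s i) (s j).
Proof. by rewrite rmorphB !uperm_hvar. Qed.

Lemma uperm_ushift a j x : uperm (ushift a j x) = ushift a (s j) (uperm x).
Proof.
move: x; apply: (@Ubar_rmorph_eq _ (uperm \o ushift a j)
  (ushift a (s j) \o uperm)) => [c|k] /=.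
  by rewrite ushift_scal !uperm_scal ushift_scal.
rewrite ushift_hvar rmorphD rmorph_int !uperm_hvar ushift_hvar.
by rewrite (inj_eq perm_inj).
Qed.

Lemma uperm_Delta j x : uperm (Delta j x) = Delta (s j) (uperm x).
Proof. by rewrite /Delta rmorphB /= uperm_ushift. Qed.

End Permutation.

Lemma uperm_tpermK i j x : uperm (tperm i j) (uperm (tperm i j) x) = x.
Proof.
move: x; apply: (@Ubar_rmorph_eq _ (uperm _ \o uperm _) idfun) => [c|k] /=.
  by rewrite !uperm_scal.
by rewrite !uperm_hvar tpermK.
Qed.

End UbarTheory.

(** * Complete symmetric polynomials *)

Section CompleteSymmetric.
Variables (U : comUnitRingType) (n : nat) (h : 'I_n -> U).
Hypothesis hU : forall j k, j != k -> h j - h k \is a GRing.unit.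
Implicit Types (J : {set 'I_n}) (j k : 'I_n).

(** The divided difference of the function t^m at the nodes [h j], j in [J]. *)
Definition lagrange_sum J m : U :=
  \sum_(j in J) h j ^+ m / \prod_(k in J | k != j) (h j - h k).

(** In the difference of the sum for m+1 and [h j] times the sum for m, the term k carries the
    factor [h k - h j]: it kills the term of j and cancels one denominator factor in every other
    term. *)
Lemma lagrange_sumD1 J m j : j \in J ->
  lagrange_sum J m.+1 = lagrange_sum (J :\ j) m + h j * lagrange_sum J m.
Proof.
move=> jJ; apply/eqP; rewrite -subr_eq; apply/eqP.
rewrite /lagrange_sum mulr_sumr -sumrB (bigD1 j) //= exprS mulrA subrr add0r.
apply: eq_big => [k|k /andP[kJ kj]]; first by rewrite !inE andbC.
rewrite mulrA -mulrBl exprS -mulrBl (bigD1 j) /=; last by rewrite jJ eq_sym.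
rewrite invrM ?hU //; last by apply: rpred_prod => l /andP[/andP[_ lk] _];
  rewrite hU // eq_sym.
rewrite [_ * h k ^+ m]mulrC -mulrA [X in _ * X]mulrCA divrr ?hU // mulr1.
by congr (_ / _); apply: eq_bigl => l; rewrite !inE; do !case: eqP;
  rewrite ?andbT ?andbF.
Qed.

Lemma lagrange_sum0 J : lagrange_sum J 0 = (#|J| == 1)%:R.
Proof.
have [m] := ubnP #|J|; elim: m J => // m IH J.
rewrite ltnS => Jm; have [-> | [a aJ]] := set_0Vmem J.
  by rewrite /lagrange_sum big_set0 cards0.
have [Ja | [b]] := set_0Vmem (J :\ a).
  have -> : J = [set a] by apply/eqP;
    rewrite eqEsubset -setD_eq0 Ja eqxx sub1set aJ.
  rewrite /lagrange_sum big_set1 cards1 expr0 big1 ?divr1 // => k.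
  by rewrite inE => /andP[->].
rewrite !inE => /andP[ba bJ].
have ca := cardsD1 a J; have cb := cardsD1 b J;
  rewrite aJ bJ /= !add1n in ca cb.
have ab : #|J :\ a| = #|J :\ b| by apply: succn_inj; rewrite -ca -cb.
have Ja : (#|J :\ a| < m)%N by rewrite -ltnS -ca ltnS.
have Jb : (#|J :\ b| < m)%N by rewrite -ab.
(* The sum with exponent 1 is expanded by removing a and by removing b. The smaller sums agree by
   induction, so [h a - h b], a unit up to sign conventions, annihilates the sum with exponent 0. *)
have := lagrange_sumD1 0 aJ; rewrite (lagrange_sumD1 0 bJ) (IH _ Ja) (IH _ Jb).
rewrite ab => /addrI/eqP; rewrite -subr_eq0 -mulrBl => /eqP e.
have -> : lagrange_sum J 0 = 0.
  by rewrite -[LHS](mulKr (hU ba)) e mulr0.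
have /negbTE Ja0 : J :\ a != set0 by apply/set0Pn; exists b; rewrite !inE ba.
by rewrite ca eqSS cards_eq0 Ja0.
Qed.

(** The complete symmetric polynomial of degree L in the variables of index at least k. As k is a
    natural number, k = n is allowed and leaves no variable. *)
Definition complete_from (k L : nat) : U :=
  \sum_(t : L.-tuple 'I_n | sorted leq (map val t) && all (leq k) (map val t))
    \prod_(i <- t) h i.

Lemma complete_from0 (k : nat) : complete_from k 0 = 1.
Proof.
rewrite /complete_from (bigD1 [tuple]) //= big_nil big1 ?addr0 // => t.
by rewrite [t]tuple0 andbC => /andP[/eqP].
Qed.

(** The head of a sorted tuple is its least index j, and the tail is a sorted tuple with indices at
    least j. *)
Lemma complete_fromS (k : nat) L : complete_from k L.+1 =
  \sum_(j < n | (k <= j)%N) h j * complete_from j L.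
Proof.
under eq_bigr do rewrite /complete_from mulr_sumr.
rewrite pair_big_dep /=.
rewrite /complete_from (reindex (fun p : 'I_n * L.-tuple 'I_n => [tuple of p.1
  :: p.2])) /=.
  apply: eq_big => [[j t]|[j t] _] /=; last by rewrite big_cons.
  rewrite path_sortedE; last exact: leq_trans.
  case kj: (k <= j)%N; rewrite ?andbF //= [_ && sorted _ _]andbC -andbA.
  congr (_ && _); apply/andb_idr => /allP jt; apply/allP => x /jt.
  exact: leq_trans.
exists (fun t : L.+1.-tuple 'I_n => (thead t, [tuple of behead t])) => [[j
  t]|t] _ /=.
  by congr (_, _); apply: val_inj.
by rewrite -tuple_eta.
Qed.

Lemma complete_from_max L : complete_from n L.+1 = 0.
Proof. by rewrite complete_fromS big1 // => j; rewrite leqNgt ltn_ord. Qed.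

Lemma complete_from_rec k L :
  complete_from k L.+1 = complete_from k.+1 L.+1 + h k * complete_from k L.
Proof.
rewrite !complete_fromS (bigD1 k) //= addrC; congr (_ + _).
by apply: eq_bigl => j; rewrite ltn_neqAle andbC eq_sym.
Qed.

(** Removing the node of least index gives the same recursion on both sides; the induction is on the
    number d of nodes, then on m. *)
Lemma lagrange_sum_from (k m : nat) : (k <= n)%N ->
  lagrange_sum [set j : 'I_n | (k <= j)%N] m =
    if (m.+1 < n - k)%N then 0 else complete_from k (m.+1 - (n - k)).
Proof.
move=> kn; have [d dE] : exists d, (n - k)%N = d by exists (n - k)%N.
rewrite dE; elim: d k kn dE m => [|d IHd] k kn dE.
  move=> m; rewrite (_ : k = n); last by apply/eqP;
    rewrite eqn_leq kn -subn_eq0 dE.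
  rewrite complete_from_max /lagrange_sum big_pred0 // => j.
  by rewrite inE leqNgt ltn_ord.
have kn' : (k < n)%N by rewrite -subn_gt0 dE.
pose k' := Ordinal kn'.
have k'in : k' \in [set j : 'I_n | (k <= j)%N] by rewrite inE leqnn.
have dE' : (n - k.+1)%N = d by rewrite subnS dE.
have Jk : [set j : 'I_n | (k <= j)%N] :\ k' = [set j : 'I_n | (k < j)%N].
  by apply/setP => j; rewrite !inE ltn_neqAle -val_eqE /= eq_sym.
elim=> [|m IHm].
  (* For m = 0 and d + 1 nodes, both sides are 1 if d = 0 and 0 otherwise; the truncated difference
     leads to degree 0, where [complete_from] is 1. *)
  rewrite lagrange_sum0 (cardsD1 k') k'in Jk.
  have := IHd k.+1 kn' dE' 0.
  rewrite subSS sub0n complete_from0 ltnS.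
  have -> : #|[set j : 'I_n | (k < j)%N]| = d.
    rewrite -[RHS]dE' -[RHS]muln1 -sum_nat_const_nat big_geq_mkord -sum1_card.
    by apply: eq_bigl => j; rewrite inE.
  by rewrite add1n eqSS => _; case: d {IHd dE dE'} .
rewrite (lagrange_sumD1 _ k'in) Jk IHm IHd // !subSS !ltnS.
(* In the boundary case m + 1 = d the second summand vanishes, and the first one is the polynomial
   of degree 0. *)
case: (ltngtP m.+1 d) => [md|md|md].
- by rewrite mulr0 addr0.
- by rewrite (subSn (ltnSE md)) (@complete_from_rec k').
by rewrite md subnn !complete_from0 mulr0 addr0.
Qed.

End CompleteSymmetric.

(** * Sums of pi(h_j) / chi_j with a common pi, and the space H *)

Section Potential.
Variables (K : fieldType) (n : nat).
Local Notation U := (Ubar K n).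
Local Notation M := {mpoly K[n]}.
Implicit Types (i j k : 'I_n) (pi : {poly K}).

Lemma hdiff_unit0 j k : j != k -> hdiff K j k \is a GRing.unit.
Proof. by move/(hdiff_unit K 0); rewrite addr0. Qed.

Lemma chi_unit j : chi K j \is a GRing.unit.
Proof. by apply: rpred_prod => k kj; rewrite hdiff_unit0 // eq_sym. Qed.

Definition hpoly j pi : M := (map_poly (@mpolyC n K) pi).['X_j].

Lemma hpolyB j : {morph hpoly j : p q / p - q}.
Proof. by move=> p q; rewrite /hpoly rmorphB hornerD hornerN. Qed.

(** Sending every variable to the single variable of [{poly K}] recovers [pi]. *)
Lemma hpoly_eq0 j pi : hpoly j pi = 0 -> pi = 0.
Proof.
move=> /(congr1 (mmap (@polyC K) (fun _ => 'X))).
rewrite rmorph0 /hpoly -horner_map /= mmapX mmap1U -map_poly_comp /=.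
under eq_map_poly do rewrite /= mmapC.
by rewrite -/(comp_poly _ _) comp_polyXr.
Qed.

Lemma hpolyE j pi :
  polyU (hpoly j pi) = \sum_(m < size pi) scalU n pi`_m * hvar K j ^+ m.
Proof.
rewrite /hpoly horner_coef size_map_poly rmorph_sum; apply: eq_bigr => m _.
by rewrite coef_map rmorphM rmorphXn.
Qed.

Lemma lagrange_sum_hsym m : lagrange_sum (@hvar K n) [set: 'I_n] m =
  if (m.+1 < n)%N then 0 else polyU (hsym K n (m.+1 - n)).
Proof.
have -> : [set: 'I_n] = [set j : 'I_n | (0 <= j)%N] by apply/setP => j;
  rewrite !inE.
rewrite lagrange_sum_from ?subn0 //; last exact: hdiff_unit0.
case: ifP => // _; rewrite /complete_from /hsym rmorph_sum.
apply: eq_big => [t|t _]; first by rewrite (introT allP) ?andbT.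
by rewrite rmorph_prod.
Qed.

Lemma sum_hpoly_chi pi :
  \sum_(j < n) polyU (hpoly j pi) / chi K j =
  \sum_(m < size pi) scalU n pi`_m * lagrange_sum (@hvar K n) [set: 'I_n] m.
Proof.
under [RHS]eq_bigr do rewrite mulr_sumr.
rewrite exchange_big /=; apply: eq_big => [j|j _]; first by rewrite inE.
rewrite hpolyE mulr_suml; apply: eq_bigr => m _; rewrite -mulrA;
  congr (_ * (_ / _)).
by apply: eq_bigl => k; rewrite inE.
Qed.

Lemma sum_hpoly_chi_inH pi : (0 < n)%N ->
  inH (\sum_(j < n) polyU (hpoly j pi) / chi K j).
Proof.
move=> n0; exists (size pi), (fun L => pi`_(L + n.-1)); rewrite sum_hpoly_chi.
under eq_bigr do rewrite lagrange_sum_hsym.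
rewrite -(big_mkord xpredT (fun m => scalU n pi`_m *
  if (m.+1 < n)%N then 0 else polyU (hsym K n (m.+1 - n)))).
rewrite -(big_mkord xpredT (fun L => scalU n pi`_(L + n.-1) * polyU (hsym K n
  L))).
have [le_n | gt_n] := leqP n.-1 (size pi); last first.
  rewrite !big_nat !big1 // => m /andP[_ mp].
    by rewrite nth_default ?/scalU ?mpolyC0 ?rmorph0 ?mul0r // (leq_trans (ltnW
      gt_n)) ?leq_addl.
  by rewrite -ltn_predRL (ltn_trans mp gt_n) mulr0.
rewrite (big_cat_nat (n := n.-1)) //= big_nat big1 ?add0r; last first.
  by move=> m /andP[_ mp]; rewrite -ltn_predRL mp mulr0.
rewrite -{1}[n.-1]add0n big_addn.
rewrite [RHS](big_cat_nat (n := size pi - n.-1)) ?leq_subr //=.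
rewrite [X in _ + X]big_nat [X in _ + X]big1 ?addr0 => [|L /andP[Ln _]];
  last first.
  rewrite nth_default ?/scalU ?mpolyC0 ?rmorph0 ?mul0r //.
  by rewrite addnC -leq_subLR.
apply: eq_bigr => L _; rewrite -addnS prednK //.
by rewrite ltnNge leq_addl /= addnK.
Qed.

Lemma inH_polynomial (f : U) : inH f -> is_polynomial f.
Proof.
case=> d [c ->]; exists (\sum_(L < d) (c L)%:MP * hsym K n L).
by rewrite rmorph_sum; apply: eq_bigr => L _; rewrite rmorphM.
Qed.

Lemma uperm_lagrange_sum (s : 'S_n) m :
  uperm K s (lagrange_sum (@hvar K n) [set: 'I_n] m) = lagrange_sum (@hvar K n)
    [set: 'I_n] m.
Proof.
rewrite /lagrange_sum [RHS](reindex_inj (@perm_inj _ s)) rmorph_sum.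
apply: eq_big => [j|j _]; first by rewrite !inE.
have U1 : \prod_(k in [set: 'I_n] | k != j) (hvar K j - hvar K k) \is a
  GRing.unit.
  by apply: rpred_prod => k /andP[_ kj]; rewrite hdiff_unit0 // eq_sym.
rewrite rmorphM rmorphXn /= uperm_hvar rmorphV //=; congr (_ / _).
rewrite rmorph_prod [RHS](reindex_inj (@perm_inj _ s)) /=;
  apply: eq_big => [k|k _].
  by rewrite !inE (inj_eq perm_inj).
by rewrite rmorphB /= !uperm_hvar.
Qed.

(** The sum over sorted tuples hides the symmetry of H_L; it is read off from the Lagrange sum with
    exponent L + n - 1, which a permutation only reindexes. *)
Lemma uperm_inH (s : 'S_n) (f : U) : (0 < n)%N -> inH f -> uperm K s f = f.
Proof.
move=> n0 [d [c ->]]; rewrite rmorph_sum; apply: eq_bigr => L _.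
rewrite rmorphM /= uperm_scal; congr (_ * _).
have := uperm_lagrange_sum s (L + n.-1); rewrite lagrange_sum_hsym.
by rewrite -addnS prednK // ltnNge leq_addl /= addnK.
Qed.

End Potential.

(** * Residues *)

Section Residue.
Variables (K : fieldType) (n : nat).
Local Notation U := (Ubar K n).
Local Notation M := {mpoly K[n]}.
Implicit Types (i j k : 'I_n) (p : {poly K}).

Lemma rmorph_hpoly (f : {rmorphism M -> M}) j k p :
  (forall c, f c%:MP = c%:MP) -> f 'X_j = 'X_k -> f (hpoly j p) = hpoly k p.
Proof.
move=> fC fX; rewrite /hpoly -horner_map /= fX -map_poly_comp /=.
by congr (_.[_]); apply: eq_map_poly => c /=; apply: fC.
Qed.

Lemma uperm_hpoly (s : 'S_n) j p :
  uperm K s (polyU (hpoly j p)) = polyU (hpoly (s j) p).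
Proof.
rewrite uperm_polyU; congr polyU; apply: (rmorph_hpoly (f := @pperm K n s)).
  by move=> c; rewrite /= /pperm comp_mpolyC.
exact: ppermX.
Qed.

Lemma DeltaB j : {morph @Delta K n j : x y / x - y}.
Proof.
by move=> x y; rewrite /Delta rmorphB !opprB [_ - ushift _ _ x]addrC addrACA [-
  y + _]addrC.
Qed.

Lemma uperm_chi (s : 'S_n) j : uperm K s (chi K j) = chi K (s j).
Proof.
rewrite rmorph_prod [RHS](reindex_inj (@perm_inj _ s)) /=.
by apply: eq_big => [k|k _]; rewrite ?(inj_eq perm_inj) // uperm_hdiff.
Qed.

Variables (a b : 'I_n).
Hypothesis ab : a != b.
Local Notation s := (tperm a b).

(** Restriction of polynomials to the hyperplane h_a = h_b. *)
Definition merge_var : M -> M :=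
  comp_mpoly [tuple if i == a then 'X_b else 'X_i | i < n].
HB.instance Definition _ := GRing.RMorphism.on merge_var.

Lemma merge_varX i : merge_var 'X_i = if i == a then 'X_b else 'X_i.
Proof. by rewrite /merge_var comp_mpolyXU -tnth_nth tnth_mktuple. Qed.

Definition offdiag (c : 'I_n) : M :=
  \prod_(k < n | (k != a) && (k != b)) ('X_c - 'X_k).

Lemma chi_offdiag_l : chi K a = polyU (('X_a - 'X_b) * offdiag a).
Proof.
rewrite /chi (bigD1 b) 1?eq_sym //= rmorphM rmorphB rmorph_prod; congr (_ * _).
by apply: eq_bigr => k _; rewrite rmorphB.
Qed.

Lemma chi_offdiag_r : chi K b = polyU (- ('X_a - 'X_b) * offdiag b).
Proof.
rewrite opprB /chi (bigD1 a) //= rmorphM rmorphB rmorph_prod; congr (_ * _).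
by apply: eq_big => [k|k _]; rewrite ?rmorphB // andbC.
Qed.

(* If [f] is invariant under [h_a |-> h_a - 1], it has no pole along
   [h_a = h_b], since its shift has none there; twice [d] is the residue. *)
Lemma residue_eq0 (d : {poly K}) (charK : [pchar K] =i pred0) :
  let f := polyU (hpoly a d) / chi K a - polyU (hpoly b d) / chi K b in
  ushift (-1) a f = f -> d = 0.
Proof.
move=> f fT; pose H : M := 'X_a - 'X_b.
pose D := H * (offdiag a * offdiag b).
pose N := hpoly a d * offdiag b + hpoly b d * offdiag a.
have fD : f * polyU D = polyU N.
  rewrite /f mulrBl.
  have -> : polyU D = chi K a * polyU (offdiag b).
    by rewrite chi_offdiag_l -rmorphM /D mulrA.
  rewrite mulrA divrK ?chi_unit //.
  have -> : chi K a * polyU (offdiag b) = chi K b * - polyU (offdiag a).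
    rewrite chi_offdiag_l chi_offdiag_r -rmorphN -!rmorphM; congr polyU.
    by rewrite !mulNr mulrN opprK mulrAC.
  by rewrite mulrA divrK ?chi_unit // mulrN opprK -!rmorphM -rmorphD.
have := congr1 (ushift (-1) a) fD; rewrite rmorphM /= fT !ushift_polyU => fD'.
have {fD fD'} e : N * pshift (-1) a D = pshift (-1) a N * D.
  apply: polyU_inj; rewrite (rmorphM _ N) (rmorphM _ (pshift _ _ N)) /=.
  by rewrite -fD -fD' mulrAC.
have [ba aa] : (b == a) = false /\ (a == b) = false by rewrite eq_sym (negbTE
  ab).
(* On h_a = h_b the factor H of D vanishes, so N or the shifted D restricts to 0. The shifted D does
   not: its factor from H becomes -1, and its other factors stay nonzero linear forms. *)
have := congr1 merge_var e; rewrite [RHS]rmorphM /= [merge_var D]rmorphM /=.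
rewrite [merge_var H]rmorphB /= !merge_varX eqxx ba subrr mul0r mulr0.
rewrite rmorphM => /eqP; rewrite mulf_eq0 /= orbC => /orP[].
  have sE c : (c == a) || (c == b) -> merge_var (pshift (-1) a (offdiag c)) !=
    0.
    move=> cab; rewrite !rmorph_prod; apply/prodf_neq0 => k /andP[ka kb].
    rewrite !rmorphB /= !pshiftX (negbTE ka) mulr0n addr0 rmorphD rmorph_int /=.
    rewrite !merge_varX (negbTE ka) addrAC.
    by case: eqP cab => /= [_ _|_ /eqP->]; apply: hlin_neq0; rewrite eq_sym.
  rewrite /D 4!rmorphM /= !mulf_eq0 (negbTE (sE _ _)) ?eqxx //.
  rewrite (negbTE (sE _ _)) ?eqxx ?orbT // !orbF rmorphB /= !pshiftX eqxx ba.
  rewrite mulr0n addr0 rmorphB rmorphD rmorph_int /= !merge_varX eqxx ba.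
  by rewrite addrAC subrr add0r oppr_eq0 oner_eq0.
have mC c : merge_var c%:MP = c%:MP by rewrite /merge_var comp_mpolyC.
have mO c : (c == a) || (c == b) -> merge_var (offdiag c) = offdiag b.
  move=> cab; rewrite rmorph_prod; apply: eq_bigr => k /andP[ka kb].
  rewrite rmorphB /= !merge_varX (negbTE ka).
  by case: eqP cab => //= _ /eqP->.
have mh c : (c == a) || (c == b) -> merge_var (hpoly c d) = hpoly b d.
  move=> cab; apply: (rmorph_hpoly (f := merge_var)) => //=.
  by rewrite merge_varX; case: eqP cab => //= _ /eqP->.
(* Both summands of N restrict to [hpoly b d * offdiag b]; characteristic 0 removes the resulting
   factor 2. *)
rewrite rmorphD !rmorphM /= !mO ?mh ?eqxx ?orbT // -mulr2n -mulr_natr.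
rewrite -(rmorph_nat (@mpolyC n K)) !mulf_eq0 mpolyC_eq0.
have [/(_ charK) -> _] := pcharf0P K; rewrite orbF => /orP[/eqP/hpoly_eq0 //|].
apply: contraTeq => _; apply/prodf_neq0 => k /andP[_ kb].
by rewrite -[X in X != _]addr0; apply: (hlin_neq0 K 0); rewrite eq_sym.
Qed.

(** In [sigma] minus its image under [s] the numerators become [w j - w (s j)], so only the terms of
    a and b survive, with opposite numerators: the shape treated by [residue_eq0]. *)
Lemma coef_eq_of_uperm_Delta (w : 'I_n -> {poly K}) (sigma : U)
    (charK : [pchar K] =i pred0) :
  sigma = \sum_(j < n) polyU (hpoly j (w j)) / chi K j ->
  Delta a sigma = uperm K s (Delta b sigma) -> w a = w b.
Proof.
move=> sE sD; apply/eqP; rewrite -subr_eq0; apply/eqP/residue_eq0 => //=.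
set d := w a - w b.
have fE : polyU (hpoly a d) / chi K a - polyU (hpoly b d) / chi K b
    = sigma - uperm K s sigma.
  rewrite {1}sE {1}sE rmorph_sum.
  rewrite [X in _ = _ - X](reindex_inj (@perm_inj _ s)) /= -sumrB.
  under eq_bigr => j _.
    rewrite rmorphM rmorphV /= ?chi_unit // uperm_hpoly uperm_chi tpermK.
    rewrite -mulrBl -rmorphB -hpolyB.
    over.
  rewrite (bigD1 a) //= (bigD1 b) 1?eq_sym //= tpermL tpermR big1.
    rewrite addr0; congr (_ + _); rewrite -mulNr -rmorphN; congr (polyU _ / _).
    by rewrite /d !hpolyB opprB.
  move=> j /andP[ja jb]; rewrite tpermD 1?eq_sym // subrr.
  by rewrite /hpoly rmorph0 horner0 rmorph0 mul0r.
(* Invariance under the shift is the vanishing of [Delta a], and [s] carries [Delta b sigma] to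
   [Delta a] of the image of [sigma]. *)
rewrite fE; apply/esym/subr0_eq.
by rewrite -[LHS]/(Delta a _) DeltaB sD uperm_Delta tpermR subrr.
Qed.

End Residue.

(** * Gauge transformations of Diff *)

Lemma divr_flip (R : comUnitRingType) (a b : R) :
  a \is a GRing.unit -> b \is a GRing.unit -> a / b * (b / a) = 1.
Proof. by move=> aU bU; rewrite mulrA divrK // divrr. Qed.

Section DiffTheory.
Variables (K : fieldType) (n : nat) (sigma : Ubar K n).
Local Notation U := (Ubar K n).
Local Notation A := (Diff sigma).
Local Notation c := (Defs.coefD sigma).
Local Notation x := (xD sigma).
Local Notation d := (dD sigma).
Local Notation hd := (hdiff K).
Implicit Types (i j k : 'I_n) (p q : U).

Lemma coefD_is_zmod : zmod_morphism c.
Proof.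
have cD p q : c (p + q) = c p + c q.
  by rewrite /Defs.coefD (pclass_rel (dr_coefD _ _ _)) pclassD.
by move=> p q; apply: (addIr (c q)); rewrite -cD !subrK.
Qed.

Lemma coefD_is_monoid : monoid_morphism c.
Proof.
split=> [|p q]; first exact: (pclass_rel (dr_coef1 _)).
by rewrite /Defs.coefD (pclass_rel (dr_coefM _ _ _)) pclassM.
Qed.

HB.instance Definition _ :=
  GRing.isZmodMorphism.Build U A c coefD_is_zmod.
HB.instance Definition _ :=
  GRing.isMonoidMorphism.Build U A c coefD_is_monoid.

Lemma coef_twist (y : A) (f : {rmorphism U -> U}) :
    (forall e : K, c (scalU n e) * y = y * c (f (scalU n e))) ->
    (forall i, c (hvar K i) * y = y * c (f (hvar K i))) ->
  forall p, c p * y = y * c (f p).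
Proof.
move=> fc fh; apply: Ubar_ind => // [p q IHp IHq|p q IHp IHq|p pU IHp].
- by rewrite !rmorphD mulrDl mulrDr IHp IHq.
- by rewrite !rmorphM -mulrA IHq !mulrA IHp.
(* For an inverse, [c (f p) * c (f p^-1) = 1] is inserted on the right of [y]; the identity for [p]
   moves [c p] to the left, where it cancels. *)
rewrite -[LHS]mulr1 -(rmorph1 c) -(rmorph1 f) -(divrr pU) (rmorphM f).
by rewrite (rmorphM c) mulrA -(mulrA (c _)) -IHp !mulrA -rmorphM mulVr //
  rmorph1 mul1r.
Qed.

Lemma coef_x p j : c p * x j = x j * c (ushift 1 j p).
Proof.
apply: coef_twist => [e|i] /=.
  by rewrite ushift_scal -!pclassM; apply: pclass_rel (dr_scalX _ _ _).
rewrite ushift_hvar (_ : _%:~R = (i == j)%:R :> U); last by case: eqP.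
by rewrite -!pclassM; apply: pclass_rel (dr_hX _ _ _).
Qed.

Lemma coef_d p j : c p * d j = d j * c (ushift (-1) j p).
Proof.
move: p; apply: coef_twist => [e|i] /=.
  by rewrite ushift_scal -!pclassM; apply: pclass_rel (dr_scalD _ _ _).
rewrite ushift_hvar (_ : _%:~R = - (i == j)%:R :> U); last first.
  by case: eqP; rewrite ?oppr0.
by rewrite -!pclassM; apply: pclass_rel (dr_hD _ _ _).
Qed.

Lemma x_coef p j : x j * c p = c (ushift (-1) j p) * x j.
Proof. by rewrite coef_x ushift_comp addrN ushift0. Qed.

Lemma d_coef p j : d j * c p = c (ushift 1 j p) * d j.
Proof. by rewrite coef_d ushift_comp addNr ushift0. Qed.

(** For i > j this is the relation of the pair (j, i) solved for x^i x^j, so that one exchange rule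
    remains available after a permutation of the indices. *)
Definition rxx i j : U :=
  if (i < j)%N then (hd i j + 1) / hd i j else hd i j / (hd i j - 1).

Definition rdd i j : U :=
  if (i < j)%N then (hd i j - 1) / hd i j else hd i j / (hd i j + 1).

Definition rxd i j : U :=
  if (i < j)%N then 1
  else hd i j * (hd i j - 2%:R) / (hd i j - 1) ^+ 2.

Lemma hdN i j : hd j i = - hd i j. Proof. by rewrite opprB. Qed.

Lemma hd_unit i j : i != j ->
  [/\ hd i j \is a GRing.unit, hd i j + 1 \is a GRing.unit &
      hd i j - 1 \is a GRing.unit].
Proof.
move=> ij; split; last exact: (hdiff_unit K (-1)).
  by move: (hdiff_unit K 0 ij); rewrite addr0.
exact: (hdiff_unit K 1).
Qed.

Lemma xD_comm i j : i != j -> x i * x j = c (rxx i j) * (x j * x i).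
Proof.
move=> ij; have [h0 h1 h2] := hd_unit ij; rewrite /rxx.
case: (ltngtP i j) => [lt_ij|lt_ji|/val_inj/eqP]; last by rewrite (negbTE ij).
  by have := pclass_rel (dr_XX sigma lt_ij); rewrite !pclassM.
have -> : x j * x i = c ((hd j i + 1) / hd j i) * (x i * x j).
  by have := pclass_rel (dr_XX sigma lt_ji); rewrite !pclassM.
rewrite mulrA -rmorphM (hdN i j) invrN mulrN -mulNr opprD opprK.
by rewrite divr_flip // rmorph1 mul1r.
Qed.

Lemma dD_comm i j : i != j -> d i * d j = c (rdd i j) * (d j * d i).
Proof.
move=> ij; have [h0 h1 h2] := hd_unit ij; rewrite /rdd.
case: (ltngtP i j) => [lt_ij|lt_ji|/val_inj/eqP]; last by rewrite (negbTE ij).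
  by have := pclass_rel (dr_DD sigma lt_ij); rewrite !pclassM.
have -> : d j * d i = c ((hd j i - 1) / hd j i) * (d i * d j).
  by have := pclass_rel (dr_DD sigma lt_ji); rewrite !pclassM.
rewrite mulrA -rmorphM (hdN i j) invrN mulrN -mulNr opprD !opprK.
by rewrite divr_flip // rmorph1 mul1r.
Qed.

Lemma xD_dD_comm i j : i != j -> x i * d j = c (rxd i j) * (d j * x i).
Proof.
move=> ij; rewrite /rxd.
case: (ltngtP i j) => [lt_ij|lt_ji|/val_inj/eqP]; last by rewrite (negbTE ij).
  by rewrite rmorph1 mul1r; have := pclass_rel (dr_XD_lt sigma lt_ij);
    rewrite !pclassM.
by have := pclass_rel (dr_XD_gt sigma lt_ji); rewrite !pclassM.
Qed.

Lemma xD_dD_diag i :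
  x i * d i = \sum_(j < n) c (1 / (1 - hd i j)) * (d j * x j) - c (Delta i
    sigma).
Proof.
rewrite -pclassM (pclass_rel (dr_XD_eq sigma i)) pclassD pclassN pclass_sum.
by congr (_ - _); apply: eq_bigr => j _; rewrite !pclassM.
Qed.

(** This and the next three identities collect on one side the coefficients of a product of two
    rescaled generators. *)
Lemma xc_xc k l p q : x k * c p * (x l * c q) = x k * x l * c (ushift 1 l p *
  q).
Proof. by rewrite mulrA -(mulrA (x k)) coef_x !mulrA -mulrA -rmorphM. Qed.

Lemma cd_cd k l p q : c p * d k * (c q * d l) = c (p * ushift 1 k q) * (d k * d
  l).
Proof. by rewrite mulrA -(mulrA (c p)) d_coef !mulrA -rmorphM. Qed.

Lemma xc_cd k l p q :
  x k * c p * (c q * d l) = c (ushift (-1) k (p * q)) * (x k * d l).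
Proof. by rewrite mulrA -(mulrA (x k)) -rmorphM x_coef !mulrA. Qed.

Lemma cd_xc k l p q :
  c p * d k * (x l * c q) = c (p * ushift 1 k (ushift (-1) l q)) * (d k * x l).
Proof. by rewrite x_coef mulrA -(mulrA (c p)) d_coef !mulrA -rmorphM. Qed.

Lemma coef_xx k l p : ushift 1 k (ushift 1 l p) = p ->
  c p * (x l * x k) = x l * x k * c p.
Proof. by move=> pE; rewrite mulrA coef_x -mulrA coef_x pE mulrA. Qed.

Section MapCoefficients.
Variables (f : {rmorphism U -> U}) (i j k l : 'I_n).
Hypotheses (ij : i != j) (ijkl : (i < j)%N = (k < l)%N).
Hypothesis fE : f (hd i j) = hd k l.

Lemma f_addn m : f (hd i j + m%:R) = hd k l + m%:R.
Proof. by rewrite (rmorphD f (hd i j)) rmorph_nat fE. Qed.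

Lemma f_subn m : f (hd i j - m%:R) = hd k l - m%:R.
Proof. by rewrite (rmorphB f (hd i j)) rmorph_nat fE. Qed.

(** An exchange coefficient depends only on h_i - h_j and on the order of the two indices, and [f]
    is compatible with both. *)
Lemma rmorph_rxx : f (rxx i j) = rxx k l.
Proof.
have [h0 h1 h2] := hd_unit ij; rewrite /rxx -ijkl.
by case: ifP => _; rewrite rmorph_div // fE ?(f_addn 1) ?(f_subn 1).
Qed.

Lemma rmorph_rdd : f (rdd i j) = rdd k l.
Proof.
have [h0 h1 h2] := hd_unit ij; rewrite /rdd -ijkl.
by case: ifP => _; rewrite rmorph_div // fE ?(f_addn 1) ?(f_subn 1).
Qed.

Lemma rmorph_rxd : f (rxd i j) = rxd k l.
Proof.
have [h0 h1 h2] := hd_unit ij; rewrite /rxd -ijkl.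
case: ifP => _; first by rewrite rmorph1.
by rewrite rmorph_div ?unitrX // rmorphXn rmorphM /= fE (f_subn 1) (f_subn 2).
Qed.

End MapCoefficients.

Lemma rxx_shift i j : i != j -> ushift 1 i (ushift 1 j (rxx i j)) = rxx i j.
Proof.
move=> ij; apply: (rmorph_rxx (f := ushift 1 i \o ushift 1 j)) => //=.
rewrite ushift_hdiff eqxx (negbTE ij) rmorphD rmorph_int /= ushift_hdiff eqxx.
by rewrite eq_sym (negbTE ij) -addrA -intrD addr0.
Qed.

Lemma one_sub_hd_unit i j : 1 - hd i j \is a GRing.unit.
Proof.
have [->|ij] := eqVneq i j; first by rewrite /hdiff subrr subr0 unitr1.
by rewrite -hdN addrC (hdiff_unit K 1) // eq_sym.
Qed.

Section Gauge.
Variables (s : 'S_n) (u v : 'I_n -> U).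
Hypothesis vu : forall j, v j * u j = 1.
Hypothesis sigmaP : forall j, uperm K s (Delta j sigma) = Delta (s j) sigma.
Hypothesis gxx : forall i j, (i < j)%N ->
  rxx (s i) (s j) * (ushift 1 (s j) (u i) * u j) =
  uperm K s (rxx i j) * (ushift 1 (s i) (u j) * u i).
Hypothesis gdd : forall i j, (i < j)%N ->
  rdd (s i) (s j) * (ushift 1 (s i) (v j) * v i) =
  uperm K s (rdd i j) * (ushift 1 (s j) (v i) * v j).
Hypothesis gxd : forall i j, i != j ->
  rxd (s i) (s j) * ushift (-1) (s i) (u i * v j) =
  uperm K s (rxd i j) * (ushift 1 (s j) (ushift (-1) (s i) (u i)) * v j).

Definition gauge_gen (g : diff_gen K n) : A :=
  match g with
  | GCoef p => c (uperm K s p)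
  | GX j => x (s j) * c (u j)
  | GD j => c (v j) * d (s j)
  end.

(** Once the coefficients are collected, the relations between generators of distinct indices are
    exactly [gxx], [gdd] and [gxd]. *)
Lemma gauge_rel t t' : diff_rel sigma t t' ->
  reval gauge_gen t = reval gauge_gen t'.
Proof.
case=> /= [|p q|p q|e j|e j|i j|i j|i j lt_ij|i j lt_ij|i j lt_ij|i j lt_ji|i].
- by rewrite !rmorph1.
- by rewrite !rmorphD.
- by rewrite !rmorphM.
- by rewrite uperm_scal mulrA coef_x ushift_scal -!mulrA -!rmorphM mulrC.
- rewrite uperm_scal -[RHS]mulrA d_coef ushift_scal !mulrA -!rmorphM.
  by rewrite mulrC.
- rewrite rmorphD /= rmorph_nat uperm_hvar mulrA coef_x ushift_hvar.
  rewrite (inj_eq perm_inj) (_ : _%:~R = (i == j)%:R :> U); last by case: eqP.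
  by rewrite -!mulrA -!rmorphM mulrC.
- rewrite rmorphB /= rmorph_nat uperm_hvar -[RHS]mulrA d_coef rmorphB /=
    rmorph_nat.
  rewrite ushift_hvar (inj_eq perm_inj) (_ : _%:~R = (i == j)%:R :> U).
    by rewrite addrK !mulrA -!rmorphM mulrC.
  by case: eqP.
- have ij : i != j by apply/eqP => e; rewrite e ltnn in lt_ij.
  have sij : s i != s j by rewrite (inj_eq perm_inj).
  have -> : (hd i j + 1) / hd i j = rxx i j by rewrite /rxx lt_ij.
  rewrite !xc_xc xD_comm // coef_xx ?rxx_shift // [RHS]mulrA coef_xx.
    by rewrite -!mulrA -!rmorphM gxx // mulrC.
  by rewrite -!uperm_ushift rxx_shift.
- have ij : i != j by apply/eqP => e; rewrite e ltnn in lt_ij.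
  have sij : s i != s j by rewrite (inj_eq perm_inj).
  have -> : (hd i j - 1) / hd i j = rdd i j by rewrite /rdd lt_ij.
  by rewrite !cd_cd dD_comm // !mulrA -!rmorphM mulrC [v i * _]mulrC gdd // [v
    j * _]mulrC.
- have ij : i != j by apply/eqP => e; rewrite e ltnn in lt_ij.
  have sij : s i != s j by rewrite (inj_eq perm_inj).
  have := gxd ij; rewrite {2}/rxd lt_ij rmorph1 mul1r => g.
  by rewrite xc_cd cd_xc xD_dD_comm // mulrA -rmorphM mulrC g mulrC.
- have ij : i != j by apply/eqP => e; rewrite e ltnn in lt_ji.
  have sij : s i != s j by rewrite (inj_eq perm_inj).
  have -> : hd i j * (hd i j - 2%:R) / (hd i j - 1) ^+ 2 = rxd i j.
    by rewrite /rxd ltnNge ltnW.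
  by rewrite xc_cd cd_xc xD_dD_comm // !mulrA -!rmorphM mulrC gxd // [v j *
    _]mulrC.
(* In the diagonal relation [u i * v i] cancels between x and d. Around each d x the opposite shifts
   cancel, leaving [v j * u j = 1], and [s] reindexes the sum. *)
rewrite mulrA -(mulrA (x _)) -rmorphM [u i * _]mulrC vu rmorph1 mulr1.
rewrite xD_dD_diag sigmaP reval_sum; congr (_ - _).
rewrite [LHS](reindex_inj (@perm_inj _ s)); apply: eq_bigr => j _ /=.
have -> : uperm K s (1 / (1 - hd i j)) = 1 / (1 - hd (s i) (s j)).
  rewrite rmorph_div ?one_sub_hd_unit //.
  by rewrite (rmorphB (uperm K s) 1) !rmorph1 uperm_hdiff.
by rewrite cd_xc ushift_comp addrN ushift0 vu rmorph1 !mul1r.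
Qed.

Lemma gauge_rmorph : exists f : {rmorphism A -> A},
  [/\ forall p, f (c p) = c (uperm K s p), forall j, f (x j) = x (s j) * c (u j)
     & forall j, f (d j) = c (v j) * d (s j)].
Proof.
have [f fE] := presented_lift gauge_rel.
by exists f; split => *; apply: fE.
Qed.

End Gauge.

End DiffTheory.

(** * Zhelobenko automorphisms *)

Section Zhelobenko.
Variables (K : fieldType) (n : nat) (sigma : Ubar K n) (a b : 'I_n).
Local Notation U := (Ubar K n).
Local Notation A := (Diff sigma).
Local Notation c := (Defs.coefD sigma).
Local Notation x := (xD sigma).
Local Notation d := (dD sigma).
Local Notation hd := (hdiff K).
Local Notation s := (tperm a b).
Local Notation h := (hd a b).
Hypothesis lt_ab : (a < b)%N.
Implicit Types (i j k : 'I_n) (p q : U) (l m : int).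

(** All coefficients for the pair (a, b) have this form up to sign and products. Shifts translate
    both arguments, so the scalar identities telescope through [hratioM]. *)
Definition hratio m l : U := (h + m%:~R) / (h + l%:~R).

Lemma neq_ab : a != b.
Proof. by rewrite -val_eqE ltn_eqF. Qed.

Lemma hm_unit m : h + m%:~R \is a GRing.unit.
Proof. exact/hdiff_unit/neq_ab. Qed.

Lemma hratioM m (k : int) l : hratio m k * hratio k l = hratio m l.
Proof. by rewrite /hratio mulrA divrK // hm_unit. Qed.

Lemma hratio1 m : hratio m m = 1.
Proof. by rewrite /hratio divrr // hm_unit. Qed.

Lemma hratio_unit m l : hratio m l \is a GRing.unit.
Proof. by rewrite unitrM unitrV !hm_unit. Qed.

Lemma hratioV m l : (hratio m l)^-1 = hratio l m.
Proof. by rewrite -[LHS]mulr1 -(hratio1 m) -(hratioM m l m) mulKr ?hratio_unit.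
  Qed.

Lemma rmorph_hratio (f : {rmorphism U -> U}) (m l r : int) :
  f h = h + r%:~R -> f (hratio m l) = hratio (m + r) (l + r).
Proof.
move=> fh; rewrite /hratio rmorph_div ?hm_unit //.
have fE (k : int) : f (h + k%:~R) = h + (k + r)%:~R.
  by rewrite (rmorphD f h) rmorph_int fh intrD -addrA [r%:~R + _]addrC.
by rewrite !fE.
Qed.

Lemma ushift_hratio_l r m l : ushift r a (hratio m l) = hratio (m + r) (l + r).
Proof.
apply: rmorph_hratio; rewrite /= ushift_hdiff eqxx eq_sym (negbTE neq_ab).
by rewrite subr0.
Qed.

Lemma ushift_hratio_r r m l : ushift r b (hratio m l) = hratio (m - r) (l - r).
Proof.
apply: rmorph_hratio; rewrite /= ushift_hdiff eqxx (negbTE neq_ab).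
by rewrite sub0r.
Qed.

Lemma ushift_hratio r k m l : k != a -> k != b ->
  ushift r k (hratio m l) = hratio m l.
Proof.
move=> ka kb; rewrite -{2}[m]addr0 -{2}[l]addr0; apply: rmorph_hratio.
by rewrite /= ushift_hdiff ![_ == k]eq_sym (negbTE ka) (negbTE kb) subrr.
Qed.

Lemma hd_ba m : hd b a + m%:~R = - (h - m%:~R).
Proof. by rewrite (hdN K a b) [RHS]opprD opprK. Qed.

Lemma uperm_hratio m l : uperm K s (hratio m l) = hratio (- m) (- l).
Proof.
rewrite /hratio rmorph_div ?hm_unit //.
have fE (k : int) : uperm K s (h + k%:~R) = - (h + (- k)%:~R).
  by rewrite (rmorphD _ h) rmorph_int /= uperm_hdiff tpermL tpermR hd_ba intrN.
by rewrite !fE invrN mulrNN.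
Qed.

Lemma rxx_ab : rxx K a b = hratio 1 0.
Proof. by rewrite /rxx lt_ab /hratio addr0. Qed.

Lemma rdd_ab : rdd K a b = hratio (-1) 0.
Proof. by rewrite /rdd lt_ab /hratio addr0. Qed.

Lemma rxx_ba : rxx K b a = hratio 0 1.
Proof.
rewrite /rxx ltnNge ltnW ?lt_ab //= (hd_ba (-1)) opprK hdN invrN mulrNN.
by rewrite /hratio addr0.
Qed.

Lemma rdd_ba : rdd K b a = hratio 0 (-1).
Proof.
rewrite /rdd ltnNge ltnW ?lt_ab //= (hd_ba 1) hdN invrN mulrNN.
by rewrite /hratio addr0.
Qed.

Lemma rxd_ab : rxd K a b = 1. Proof. by rewrite /rxd lt_ab. Qed.

Lemma rxd_ba : rxd K b a = hratio 0 1 * hratio 2 1.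
Proof.
rewrite /rxd ltnNge ltnW ?lt_ab //= (hd_ba (-1)) (hd_ba (-2)) !opprK hdN.
by rewrite sqrrN mulrNN expr2 invrM ?(hm_unit 1) // /hratio addr0 mulrACA.
Qed.

Hypothesis ab : b = a.+1 :> nat.
Hypothesis sigmaP : forall j, uperm K s (Delta j sigma) = Delta (s j) sigma.

Definition near k := (k == a) || (k == b).

Lemma farP k : ~~ near k -> [/\ k != a, k != b & s k = k].
Proof.
by rewrite negb_or => /andP[ka kb]; rewrite tpermD // eq_sym.
Qed.

(** No index lies strictly between the neighbours a and b, so only the pair {a, b} itself changes
    its order. *)
Lemma tperm_lt i j : i != j -> ~~ (near i && near j) -> (s i < s j)%N = (i <
  j)%N.
Proof.
rewrite negb_and => ij /orP[] /farP[ka kb ->];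
  case: tpermP => [e|e|//]; move: ka kb ij; rewrite -!val_eqE /= ?e; move: ab;
    lia.
Qed.

Section OneGauge.
Variables (e : 'I_n) (m l : int).

(** A Zhelobenko map and its inverse each rescale a single index e, equal to a or to b. *)
Definition gauge_u j : U := if j == e then - hratio m l else 1.
Definition gauge_v j : U := if j == e then - hratio l m else 1.

Hypothesis ne : near e.
Local Notation u := gauge_u.
Local Notation v := gauge_v.

Lemma gauge_vu j : v j * u j = 1.
Proof.
by rewrite /v /u; case: ifP => _; rewrite ?mulr1 // mulrNN hratioM hratio1.
Qed.

Lemma gauge_far j : ~~ near j -> u j = 1 /\ v j = 1.
Proof.
by rewrite /u /v => fj; have [je|//] := eqVneq j e; rewrite je ne in fj.
Qed.

Lemma ushift_gauge_far r k j : ~~ near k ->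
  ushift r k (u j) = u j /\ ushift r k (v j) = v j.
Proof.
move=> /farP[ka kb _]; rewrite /u /v; case: ifP => _; rewrite ?rmorph1 //.
by rewrite !rmorphN /= !ushift_hratio.
Qed.

(** Only the pair {a, b} needs checking: for any other pair [s] transports the exchange coefficient,
    and the factors of the index outside {a, b} are 1 while its shifts fix the remaining factors. *)
Lemma gauge_exists :
    rxx K b a * (ushift 1 a (u a) * u b) =
      uperm K s (rxx K a b) * (ushift 1 b (u b) * u a) ->
    rdd K b a * (ushift 1 b (v b) * v a) =
      uperm K s (rdd K a b) * (ushift 1 a (v a) * v b) ->
    rxd K b a * ushift (-1) b (u a * v b) =
      uperm K s (rxd K a b) * (ushift 1 a (ushift (-1) b (u a)) * v b) ->
    rxd K a b * ushift (-1) a (u b * v a) =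
      uperm K s (rxd K b a) * (ushift 1 b (ushift (-1) a (u b)) * v a) ->
  exists f : {rmorphism A -> A},
  [/\ forall p, f (c p) = c (uperm K s p), forall j, f (x j) = x (s j) * c (u j)
     & forall j, f (d j) = c (v j) * d (s j)].
Proof.
move=> gxx gdd gxd1 gxd2.
have upermE i j : uperm K s (hd i j) = hd (s i) (s j) by rewrite uperm_hdiff.
have near_lt i j : (i < j)%N -> near i && near j -> i = a /\ j = b.
  move=> ij /andP[/orP[]/eqP ie /orP[]/eqP je]; move: ij ab; rewrite ie je //;
    lia.
apply: gauge_rmorph => //; first exact: gauge_vu.
- move=> i j lt_ij; have ij : i != j by apply: contraTneq lt_ij => ->;
    rewrite ltnn.
  have [/(near_lt _ _ lt_ij)[-> ->]|far] := boolP (near i && near j).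
    by rewrite tpermL tpermR.
  rewrite (rmorph_rxx ij (esym (tperm_lt ij far))) //; congr (_ * _).
  move: far; rewrite negb_and => /orP[] fk; have [ka kb ->] := farP fk;
  by rewrite !(ushift_gauge_far _ _ fk).1 (gauge_far fk).1 !rmorph1 mul1r mulr1.
- move=> i j lt_ij; have ij : i != j by apply: contraTneq lt_ij => ->;
    rewrite ltnn.
  have [/(near_lt _ _ lt_ij)[-> ->]|far] := boolP (near i && near j).
    by rewrite tpermL tpermR.
  rewrite (rmorph_rdd ij (esym (tperm_lt ij far))) //; congr (_ * _).
  move: far; rewrite negb_and => /orP[] fk; have [ka kb ->] := farP fk;
  by rewrite !(ushift_gauge_far _ _ fk).2 (gauge_far fk).2 !rmorph1 mul1r mulr1.
move=> i j ij; have [near_ij|far] := boolP (near i && near j).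
  case: (ltngtP i j) => [lt_ij|lt_ji|/val_inj/eqP]; last by rewrite (negbTE ij).
    by have [-> ->] := near_lt _ _ lt_ij near_ij; rewrite tpermL tpermR.
  rewrite andbC in near_ij.
  by have [-> ->] := near_lt _ _ lt_ji near_ij; rewrite tpermL tpermR.
rewrite (rmorph_rxd ij (esym (tperm_lt ij far))) //; congr (_ * _).
move: far; rewrite negb_and => /orP[] fk; have [ka kb ->] := farP fk.
  by rewrite (gauge_far fk).1 !rmorph1 !mul1r (ushift_gauge_far _ _ fk).2.
by rewrite (gauge_far fk).2 !mulr1 ushiftC (ushift_gauge_far _ _ fk).1.
Qed.

End OneGauge.

Lemma uperm_rxx_ab : uperm K s (rxx K a b) = hratio (-1) 0.
Proof. by rewrite rxx_ab uperm_hratio oppr0. Qed.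

Lemma uperm_rdd_ab : uperm K s (rdd K a b) = hratio 1 0.
Proof. by rewrite rdd_ab uperm_hratio oppr0 opprK. Qed.

Lemma uperm_rxd_ab : uperm K s (rxd K a b) = 1.
Proof. by rewrite rxd_ab rmorph1. Qed.

Lemma uperm_rxd_ba : uperm K s (rxd K b a) = hratio 0 (-1) * hratio (-2) (-1).
Proof. by rewrite rxd_ba rmorphM /= !uperm_hratio oppr0. Qed.

Lemma zhelobenko_exists :
  exists2 f : {rmorphism A -> A}, bijective f & zhelobenko f a b.
Proof.
have [na nb] : near a /\ near b by rewrite /near !eqxx orbT.
have [ab0 ba0] : (a == b) = false /\ (b == a) = false.
  by rewrite [b == a]eq_sym (negbTE neq_ab).
have gE := (rxx_ba, rdd_ba, rxd_ab, rxd_ba, uperm_rxx_ab, uperm_rdd_ab,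
  uperm_rxd_ab, uperm_rxd_ba).
have sE := (ushift_hratio_l, ushift_hratio_r).
have [f [fc fx fd]] : exists f : {rmorphism A -> A},
  [/\ forall p, f (c p) = c (uperm K s p),
      forall j, f (x j) = x (s j) * c (gauge_u a 0 (-1) j)
    & forall j, f (d j) = c (gauge_v a 0 (-1) j) * d (s j)].
  apply: gauge_exists => //; rewrite !gE /gauge_u /gauge_v eqxx ba0.
  - by rewrite rmorph1 rmorphN /= sE !mulr1 !mul1r !mulrN !hratioM !hratio1.
  - by rewrite rmorph1 rmorphN /= sE !mulr1 !mul1r !mulrN !hratioM !hratio1.
  - rewrite !mulr1 !mul1r !rmorphN /= !sE !mulrN [hratio 0 1 * _]mulrC -mulrA.
    by rewrite hratioM hratio1 mulr1.
  - rewrite !rmorph1 !mul1r !rmorphN /= !sE !mulrN [hratio 0 _ * _]mulrC -mulrA.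
    by rewrite hratioM hratio1 mulr1.
(* The inverse. Solving g (f x^a) = x^a, with [s] changing the sign of h, forces g x^b = - x^a
   (h+1)/h. *)
have [g [gc gx gd]] : exists f : {rmorphism A -> A},
  [/\ forall p, f (c p) = c (uperm K s p),
      forall j, f (x j) = x (s j) * c (gauge_u b 1 0 j)
    & forall j, f (d j) = c (gauge_v b 1 0 j) * d (s j)].
  apply: gauge_exists => //; rewrite !gE /gauge_u /gauge_v eqxx ab0.
  - by rewrite rmorph1 rmorphN /= sE !mulr1 !mul1r !mulrN !hratioM !hratio1.
  - by rewrite rmorph1 rmorphN /= sE !mulr1 !mul1r !mulrN !hratioM !hratio1.
  - by rewrite !rmorph1 !mul1r !rmorphN /= !sE !mulrN -mulrA hratioM hratio1
      mulr1.
  - by rewrite !mulr1 !mul1r !rmorphN /= !sE !mulrN -mulrA hratioM hratio1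
      mulr1.
have uK j : gauge_u b 1 0 (s j) * uperm K s (gauge_u a 0 (-1) j) = 1.
  rewrite /gauge_u (canF_eq (tpermK a b)) tpermR; case: ifP => _.
    by rewrite rmorphN /= uperm_hratio mulrNN hratioM hratio1.
  by rewrite rmorph1 mulr1.
have uK' j : gauge_u a 0 (-1) (s j) * uperm K s (gauge_u b 1 0 j) = 1.
  rewrite /gauge_u (canF_eq (tpermK a b)) tpermL; case: ifP => _.
    by rewrite rmorphN /= uperm_hratio mulrNN hratioM hratio1.
  by rewrite rmorph1 mulr1.
have vK j : uperm K s (gauge_v a 0 (-1) j) * gauge_v b 1 0 (s j) = 1.
  rewrite /gauge_v (canF_eq (tpermK a b)) tpermR; case: ifP => _.
    by rewrite rmorphN /= uperm_hratio mulrNN hratioM hratio1.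
  by rewrite rmorph1 mulr1.
have vK' j : uperm K s (gauge_v b 1 0 j) * gauge_v a 0 (-1) (s j) = 1.
  rewrite /gauge_v (canF_eq (tpermK a b)) tpermL; case: ifP => _.
    by rewrite rmorphN /= uperm_hratio mulrNN hratioM hratio1.
  by rewrite rmorph1 mulr1.
exists f.
  exists g.
    apply: (presented_rmorph_eq (f := g \o f) (g := idfun)) => -[p|j|j] /=.
    - by rewrite [f _]fc [g _]gc uperm_tpermK.
    - by rewrite [f _]fx rmorphM /= gc gx tpermK -mulrA -rmorphM uK rmorph1
        mulr1.
    - by rewrite [f _]fd rmorphM /= gc gd tpermK mulrA -rmorphM vK rmorph1
        mul1r.
  apply: (presented_rmorph_eq (f := f \o g) (g := idfun)) => -[p|j|j] /=.
  - by rewrite [g _]gc [f _]fc uperm_tpermK.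
  - by rewrite [g _]gx rmorphM /= fc fx tpermK -mulrA -rmorphM uK' rmorph1
      mulr1.
  - by rewrite [g _]gd rmorphM /= fc fd tpermK mulrA -rmorphM vK' rmorph1 mul1r.
split.
- by move=> e; rewrite fc uperm_scal.
- by move=> j; rewrite fc uperm_hvar.
- by rewrite fx tpermL /gauge_u eqxx rmorphN mulrN /hratio addr0.
- by rewrite fx tpermR /gauge_u ba0 rmorph1 mulr1.
- by move=> j ja jb; rewrite fx tpermD 1?eq_sym // /gauge_u (negbTE ja) rmorph1
    mulr1.
- by rewrite fd tpermL /gauge_v eqxx rmorphN mulNr /hratio addr0.
- by rewrite fd tpermR /gauge_v ba0 rmorph1 mul1r.
- by move=> j ja jb; rewrite fd tpermD 1?eq_sym // /gauge_v (negbTE ja) rmorph1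
    mul1r.
Qed.

End Zhelobenko.

(** * The action of Diff on Ubar *)

Section Cancel.
Variable R : comPzRingType.
Implicit Types a b x y z q w u f v h : R.

(** The scalar identities behind [act_rel], every shifted function being a variable; [a * b = 1]
    stands for two inverse [hratio] factors. *)
Lemma cancel_xx a b x y z : a * b = 1 -> x * z * y = a * (x * (y * b) * z).
Proof. by move=> ab; rewrite -[LHS]mul1r -ab; ring. Qed.

Lemma cancel_dd a b q w w' u u' f : a * b = 1 ->
  w * u * (w' * q * u' * f) = a * (w' * u' * (w * b * (u * q) * f)).
Proof. by move=> ab; rewrite -[LHS]mul1r -ab; ring. Qed.

Lemma cancel_xd_lt w q u f v : w * q * u * f * v = w * u * (f * (v * q)).
Proof. by ring. Qed.

Lemma cancel_xd_gt w q q' u f v :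
  w * q * (u * q') * f * v = q * q' * (w * u * (f * v)).
Proof. by ring. Qed.

Lemma cancel_diag h v w :
  (h + 1) * v = 1 -> 1 * v * w - (w - w * (h * v)) = 0.
Proof.
move=> hv; transitivity (w * ((h + 1) * v - 1)); first by ring.
by rewrite hv subrr mulr0.
Qed.

End Cancel.

Section Representation.
Variables (K : fieldType) (n : nat) (w : 'I_n -> {poly K}).
Local Notation U := (Ubar K n).
Local Notation hd := (hdiff K).
Implicit Types (i j k : 'I_n) (e f g : U) (r : int).

Definition wterm j : U := polyU (hpoly j (w j)) / chi K j.

(** The factor E_j. The product being one-sided, for i < j the shift of h_i fixes E_j while that of
    h_j changes one factor of E_i, which produces the coefficient in x^i x^j. *)
Definition upper j : U := \prod_(k < n | (j < k)%N) hd j k.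

Lemma upper_unit j : upper j \is a GRing.unit.
Proof.
apply: rpred_prod => k jk; apply: hdiff_unit0.
by apply: contraTneq jk => ->; rewrite ltnn.
Qed.

Lemma ushift_hdiff_r r i j : i != j -> ushift r j (hd i j) = hd i j - r%:~R.
Proof. by move=> ij; rewrite ushift_hdiff eqxx (negbTE ij) sub0r intrN. Qed.

Lemma ushift_hdiff_far r i j k :
  i != k -> j != k -> ushift r k (hd i j) = hd i j.
Proof.
by move=> ik jk; rewrite ushift_hdiff (negbTE ik) (negbTE jk) subrr addr0.
Qed.

Lemma ushift_upper_lt r i j : (i < j)%N -> ushift r i (upper j) = upper j.
Proof.
move=> ij; rewrite rmorph_prod; apply: eq_bigr => k jk.
by apply: ushift_hdiff_far; rewrite -val_eqE gtn_eqF // (ltn_trans ij).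
Qed.

Lemma ushift_upper_gt r i j : (i < j)%N ->
  ushift r j (upper i) = upper i * ((hd i j - r%:~R) / hd i j).
Proof.
move=> lt_ij; have ij : i != j by apply: contraTneq lt_ij => ->; rewrite ltnn.
rewrite rmorph_prod /upper !(bigD1 (P := fun k : 'I_n => (i < k)%N) j) //=.
rewrite ushift_hdiff_r // [RHS]mulrAC [hd i j * _]mulrC divrK ?hdiff_unit0 //.
congr (_ * _).
by apply: eq_bigr => k /andP[_ kj]; apply: ushift_hdiff_far.
Qed.

(** The variable h_i enters w_j only through the factor h_j - h_i of chi_j. *)
Lemma ushift_wterm r i j : i != j ->
  ushift r i (wterm j) = wterm j * (hd j i / (hd j i - r%:~R)).
Proof.
move=> ij; have ji : j != i by rewrite eq_sym.
rewrite rmorph_div ?chi_unit //= ushift_polyU.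
rewrite (rmorph_hpoly (f := @pshift K n r i) (k := j)); last first.
- by rewrite /= pshiftX (negbTE ji) mulr0n addr0.
- by move=> c; rewrite /= /pshift comp_mpolyC.
rewrite /wterm /chi (bigD1 i) //= rmorphM rmorph_prod /= ushift_hdiff_r //.
set P := \prod_(k < n | _) _; set P' := \prod_(k < n | _) _.
have -> : P = P' by apply: eq_bigr => k /andP[kj ki]; rewrite ushift_hdiff_far.
have PU : P' \is a GRing.unit.
  by apply: rpred_prod => k /andP[kj ki]; rewrite hdiff_unit0 // eq_sym.
have hU : hd j i - r%:~R \is a GRing.unit by rewrite -intrN hdiff_unit.
rewrite !invrM ?hdiff_unit0 // -!mulrA; congr (_ * (_ * _)).
by rewrite mulKr ?hdiff_unit0.
Qed.

Section Pair.
Variables (i j : 'I_n).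
Hypothesis lt_ij : (i < j)%N.
Local Notation q := (hratio K i j).

Lemma neq_ij : i != j.
Proof. by rewrite -val_eqE ltn_eqF. Qed.

Lemma ushift_upper r : ushift r j (upper i) = upper i * q (- r) 0.
Proof. by rewrite ushift_upper_gt // /hratio addr0 intrN. Qed.

Lemma ushift_upperV r : ushift r j (upper i)^-1 = (upper i)^-1 * q 0 (- r).
Proof.
rewrite rmorphV ?upper_unit //= ushift_upper invrM ?upper_unit ?hratio_unit //.
by rewrite hratioV // mulrC.
Qed.

Lemma ushift_wterm_l r : ushift r i (wterm j) = wterm j * q 0 r.
Proof.
rewrite ushift_wterm ?neq_ij // -[_ - r%:~R]opprK opprB (hdN K i j) opprK addrC.
by rewrite invrN mulrNN /hratio addr0.
Qed.

Lemma ushift_wterm_r r : ushift r j (wterm i) = wterm i * q 0 (- r).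
Proof. by rewrite ushift_wterm 1?eq_sym ?neq_ij // /hratio addr0 intrN. Qed.

End Pair.

Fixpoint act (t : rterm (diff_gen K n)) : U -> U :=
  match t with
  | Gen (GCoef p) => fun f => p * f
  | Gen (GX j) => fun f => ushift (-1) j f / upper j
  | Gen (GD j) => fun f => wterm j * ushift 1 j (upper j) * ushift 1 j f
  | Zero => fun=> 0
  | One => id
  | Opp t => fun f => - act t f
  | Add s t => fun f => act s f + act t f
  | Mul s t => fun f => act s (act t f)
  end.

(** Right distributivity in the congruence holds for composed operators only if they are
    additive. *)
Lemma actD t f g : act t (f + g) = act t f + act t g.
Proof.
elim: t f g => [[p|j|j]|||t IH|s IHs t IHt|s IHs t IHt] f g //=.
- by rewrite mulrDr.
- by rewrite rmorphD mulrDl.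
- by rewrite rmorphD mulrDr.
- by rewrite addr0.
- by rewrite IH opprD.
- by rewrite IHs IHt addrACA.
- by rewrite IHt IHs.
Qed.

Lemma act_sum (I : Type) (s : seq I) (F : I -> rterm (diff_gen K n)) f :
  act (\big[@Add _/Zero]_(i <- s) F i) f = \sum_(i <- s) act (F i) f.
Proof. exact: (@big_morph _ _ (fun t => act t f)). Qed.

Definition sigma_w : U := \sum_(j < n) wterm j.

Lemma ushiftM3 r i f g e :
  ushift r i (f * g * e) = ushift r i f * ushift r i g * ushift r i e.
Proof. by rewrite !rmorphM. Qed.

Lemma act_rel s t : diff_rel sigma_w s t -> act s =1 act t.
Proof.
case=> [|p q|p q|c j|c j|i j|i j|i j lt_ij|i j lt_ij|i j lt_ij|i j lt_ji|i] f
  /=.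
- by rewrite mul1r.
- by rewrite mulrDl.
- by rewrite mulrA.
- by rewrite rmorphM /= ushift_scal mulrA.
- by rewrite rmorphM /= ushift_scal mulrCA.
- rewrite rmorphM rmorphD rmorph_nat /= ushift_hvar mulrA.
  by case: eqP => _; [rewrite (intrN _ 1) subrK | rewrite !addr0].
- rewrite rmorphM rmorphB rmorph_nat /= ushift_hvar mulrCA.
  by case: eqP => _; [rewrite addrK | rewrite addr0 subr0].
- have -> : (hd i j + 1) / hd i j = hratio K i j 1 0 by rewrite /hratio addr0.
  have e : hratio K i j 1 0 * hratio K i j 0 1 = 1 by rewrite hratioM //
    hratio1.
  rewrite !rmorphM /= (ushift_upperV lt_ij) rmorphV ?upper_unit //=.
  rewrite ushift_upper_lt // ushiftC opprK.
  by apply: cancel_xx e.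
- have -> : (hd i j - 1) / hd i j = hratio K i j (-1) 0.
    by rewrite /hratio addr0.
  have e : hratio K i j (-1) 0 * hratio K i j 0 (-1) = 1.
    by rewrite hratioM // hratio1.
  rewrite !ushiftM3 (ushift_wterm_l lt_ij) (ushift_wterm_r lt_ij).
  rewrite (ushiftC 1 1 i j (upper j)) (ushift_upper_lt 1 lt_ij).
  rewrite (ushiftC 1 1 j i (upper i)) (ushift_upper lt_ij) (rmorphM _ (upper
    i)) /=.
  rewrite (ushift_hratio_l K lt_ij) (ushiftC 1 1 j i f).
  by apply: cancel_dd e.
- rewrite ushiftM3 (rmorphM _ (ushift (-1) i f)) /= (ushift_wterm_l lt_ij)
    (ushift_upperV lt_ij).
  rewrite (ushiftC (-1) 1 i j (upper j)) (ushift_upper_lt _ lt_ij).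
  rewrite (ushiftC (-1) 1 i j f).
  by apply: cancel_xd_lt.
- have -> : hd i j * (hd i j - 2%:R) / (hd i j - 1) ^+ 2 = rxd K i j.
    by rewrite /rxd ltnNge ltnW.
  rewrite (rxd_ba K lt_ji) ushiftM3 (rmorphM _ (ushift (-1) i f)) /=
    (ushift_wterm_r lt_ji).
  rewrite rmorphV ?upper_unit //= (ushift_upper_lt _ lt_ji).
  rewrite (ushiftC (-1) 1 i j (upper j)) (ushift_upper lt_ji) (rmorphM _ (upper
    j)) /=.
  rewrite (ushift_hratio_l K lt_ji) (ushiftC (-1) 1 i j f).
  by apply: cancel_xd_gt.
(* Here x^i d_i acts as multiplication by w_i[-eps_i], and each d_j x^j as multiplication by w_j. *)
rewrite act_sum ushiftM3 !ushift_comp !addNr !ushift0 [_ * upper i * _]mulrAC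
  mulrK ?upper_unit //.
under eq_bigr => j _.
  rewrite /= (rmorphM _ (ushift (-1) j f)) rmorphV ?upper_unit //= ushift_comp
    addrN ushift0.
  rewrite [wterm j * _ * _]mulrACA divrr ?rmorph_unit ?upper_unit // mulr1
    mulrA.
  over.
rewrite -mulr_suml -mulrBl; congr (_ * _).
(* The term j = i gives w_i - (w_i - w_i[-eps_i]), which is the left side. For j different from i,
   both w_j / (1 - h_ij) and [Delta i] of w_j equal w_j / (1 + h_ji), so they cancel. *)
rewrite /Delta /sigma_w rmorph_sum -sumrB -sumrB (bigD1 i) //= big1 ?addr0.
  by rewrite /hdiff subrr subr0 divr1 mul1r opprB addrC subrK.
move=> j ji; have ij : i != j by rewrite eq_sym.
rewrite ushift_wterm // intrN opprK -(hdN K i j) [1 + _]addrC.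
exact: cancel_diag (divrr (hdiff_unit K 1 ji)).
Qed.

Lemma act_rcong s t : rcong (diff_rel sigma_w) s t -> act s =1 act t.
Proof.
elim=> {s t} [s t /act_rel //|//|s t _ IH|s t u _ IHs _ IHt|s s' _ IH
  |s s' t t' _ IHs _ IHt|s s' t t' _ IHs _ IHt|s t u|s t|t|t|//|//|//|//|s t u]
  f /=.
- by rewrite IH.
- by rewrite IHs IHt.
- by rewrite IH.
- by rewrite IHs IHt.
- by rewrite IHt IHs.
- by rewrite addrA.
- by rewrite addrC.
- by rewrite add0r.
- by rewrite addNr.
by rewrite actD.
Qed.

(** The class of the coefficient [p] sends 1 to [p]. *)
Lemma coefD_inj : injective (Defs.coefD sigma_w).
Proof.
by move=> p q /pclassP/act_rcong/(_ 1) /=; rewrite !mulr1.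
Qed.

End Representation.

(** The relation for x^b d_b is used because [f] sends x^b and d_b to x^a and d_a without factors.
    Its image and the relation for x^a d_a have the same sums of d_j x^j, so the potential terms
    agree. *)
Lemma zhelobenko_Delta (K : fieldType) (n : nat) (sigma : Ubar K n)
    (f : {rmorphism Diff sigma -> Diff sigma}) (a b : 'I_n) :
    injective (Defs.coefD sigma) -> a != b -> zhelobenko f a b ->
  Delta a sigma = uperm K (tperm a b) (Delta b sigma).
Proof.
move=> c_inj ab [fs fh fx fx' fxj fd fd' fdj]; set s := tperm a b.
have fc p : f (Defs.coefD sigma p) = Defs.coefD sigma (uperm K s p).
  move: p; apply: (@Ubar_rmorph_eq K n _ (f \o Defs.coefD sigma)
    (Defs.coefD sigma \o uperm K s)) => [c|i] /=.
    by rewrite uperm_scal.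
  by rewrite uperm_hvar.
have [h0 _ h1] := hd_unit K ab.
have fdx j : f (dD sigma j * xD sigma j) = dD sigma (s j) * xD sigma (s j).
  rewrite rmorphM /=; have [->|ja] := eqVneq j a.
    (* The coefficient on the right passes x^b and d_b with opposite shifts, hence unchanged, and
       cancels the one on the left. *)
    rewrite fd fx tpermL mulrNN cd_xc ushift_comp addrN ushift0.
    by rewrite divr_flip // rmorph1 mul1r.
  have [->|jb] := eqVneq j b; first by rewrite fd' fx' tpermR.
  by rewrite fdj // fxj // tpermD // eq_sym.
have := congr1 f (xD_dD_diag sigma b).
rewrite rmorphB rmorph_sum rmorphM /= fx' fd' fc xD_dD_diag.
under [in RHS]eq_bigr => j _.
  rewrite rmorphM /= fdx fc.
  have -> : uperm K s (1 / (1 - hdiff K b j)) = 1 / (1 - hdiff K a (s j)).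
    rewrite rmorph_div ?one_sub_hd_unit //.
    by rewrite (rmorphB (uperm K s) 1) !rmorph1 uperm_hdiff tpermR.
  over.
rewrite (reindex_inj (@perm_inj _ s)) /= => /addrI/oppr_inj.
exact: c_inj.
Qed.

(** * Zhelobenko automorphisms exist exactly when all numerators pi_j coincide *)

Theorem lemma3p7 (K : fieldType) (n : nat) (charK : [pchar K] =i pred0)
    (n_ge1 : (1 <= n)%N) (sigma : Ubar K n) (sigmaW : inW sigma) :
  admits_zhelobenko sigma <-> (is_polynomial sigma /\ inH sigma).
Proof.
split=> [adm | [_ sigmaH] a b ab]; last first.
  apply: zhelobenko_exists => //; first by rewrite ab.
  by move=> j; rewrite uperm_Delta uperm_inH.
suff sigmaH : inH sigma by split; [exact: inH_polynomial|].
case: sigmaW => w /fin_all_exists[pi piE] sigmaE.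
have {w piE} sigmaE : sigma = sigma_w pi.
  by rewrite sigmaE; apply: eq_bigr => j _; apply: piE.
have pi_step (a b : 'I_n) : b = a.+1 :> nat -> pi a = pi b.
  move=> ab; have neq_ab : a != b by rewrite -val_eqE /= ab ltn_eqF.
  apply: (coef_eq_of_uperm_Delta neq_ab charK sigmaE).
  have [f _ /zhelobenko_Delta] := adm a b ab; apply=> //.
  by rewrite sigmaE; apply: coefD_inj.
(* Equality for neighbours propagates down to the index 0, which exists as n >= 1. *)
have pi_const (j : 'I_n) : pi j = pi (Ordinal n_ge1).
  case: j => m; elim: m => [|m IH] mn; first by congr pi; apply: val_inj.
  by rewrite -(IH (ltnW mn)); apply/esym/pi_step.
rewrite sigmaE /sigma_w /wterm.
under eq_bigr do rewrite pi_const.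
exact: sum_hpoly_chi_inH.
Qed.
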